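(* Suppose the half spaces $H_1^+,\dots,H_m^+\subset\mathbb{R}^n$ satisfy the good clipping conditions: (A) for every $I\subset[m-1]$, $F^{|I|-1}\cap H_I=\varnothing$; (B) for every $I\subset[m-1]$ and every $\mathbf{v}\in F^{|I|}\cap H_I$, $\ \prod_{t\in I}A_{*_{\mathbf{v}}}^{(I\setminus t)\cup m}\ \prod_{t\in\bullet_{\mathbf{v}}}A_{*_{\mathbf{v}}\cup t}^{I\cup m}\ne 0$. Then $$\operatorname{vol}([0,1]^n\cap H^+)=\sum_{I\subset[m-1]}\;\sum_{\mathbf{v}\in F^{|I|}\cap H_I}\frac{(-1)^{|0_{\mathbf{v}}|+\frac{|I|(|I|-1)}{2}+n|I|}\,\bigl(g_m(\mathbf{v})\,A_{*_{\mathbf{v}}}^{I}\bigr)^n}{n!\,\bigl|A_{*_{\mathbf{v}}}^{I}\bigr|\,\prod_{t\in I}A_{*_{\mathbf{v}}}^{(I\setminus t)\vee m}\,\prod_{t\in\bullet_{\mathbf{v}}}A_{*_{\mathbf{v}}\vee t}^{m\vee I}} .$$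
   Context: $n,m\ge 1$, $[k]=\{1,\dots,k\}$ (with $[0]=\varnothing$). For $i\in[m]$, $g_i(\mathbf{x})=a_{1,i}x_1+\cdots+a_{n,i}x_n+r_i$ is a non-constant real affine function on $\mathbb{R}^n$, $H_i=\{g_i=0\}$, $H_i^+=\{g_i\ge 0\}$, $H^+=\bigcap_{i\in[m]}H_i^+$, and $A=(a_{j,i})$ is the $n\times m$ coefficient matrix (the $i$-th column is the coefficient vector of $g_i$). For $I\subset[m-1]$, $H_I=\bigl(\bigcap_{i\in I}H_i\bigr)\cap H^+\setminus H_m$. $F^d$ is the set of points of $[0,1]^n$ having exactly $d$ coordinates different from $0$ and $1$ (and $F^{-1}=\varnothing$). For $\mathbf{v}\in\mathbb{R}^n$: $0_{\mathbf{v}}=\{i: v_i=0\}$, $1_{\mathbf{v}}=\{i: v_i=1\}$, $*_{\mathbf{v}}=\{i: v_i\ne 0,1\}$, $\bullet_{\mathbf{v}}=0_{\mathbf{v}}\cup 1_{\mathbf{v}}$, all regarded as lists in increasing order. For ordered lists $J$ of row indices and $K$ of column indices of equal length, $A_J^K$ is the determinant of the matrix whose $(p,q)$ entry is the entry of $A$ in row $J_p$ and column $K_q$ (the order of $J,K$ matters); $A_\varnothing^\varnothing=1$. Sets of indices are listed in increasing order; $\cup$ is union listed in increasing order, while $J\vee K$ is the concatenation of the list $J$ followed by the list $K$; a single index stands for a one-element list. $|S|$ is cardinality. $\operatorname{vol}$ is Lebesgue measure. *)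

(* Defs.v *)
From HB Require Import structures.
From mathcomp Require Import all_boot all_order all_algebra.
From mathcomp Require Import all_classical all_reals all_analysis.
Set Implicit Arguments.
Unset Strict Implicit.
Unset Printing Implicit Defensive.
Import Order.TTheory GRing.Theory Num.Theory.
Import numFieldNormedType.Exports.
Local Open Scope classical_set_scope.
Local Open Scope ring_scope.

(* Points of R^n are n-tuples, because the library equips [n.-tuple T] with
   the product sigma-algebra; [measurableTypeR R] is [R] with its Borel sets. *)
Notation point R n := (n.-tuple (measurableTypeR R)).

Section LebesgueTuple.
Context {R : realType}.

(* Lebesgue measure on R^n: the n-fold product of [lebesgue_measure], built by
   transporting products along [(a, t) |-> a :: t]. *)
Definition cons_point n (p : measurableTypeR R * point R n) : point R n.+1 :=
  [the n.+1.-tuple (measurableTypeR R) of p.1 :: p.2].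

Lemma measurable_cons_point n : measurable_fun setT (@cons_point n).
Proof. exact: measurable_cons. Qed.

Section Step.
Context n (mu : {sigma_finite_measure set (point R n) -> \bar R}).

Definition lebesgue_cons : set (point R n.+1) -> \bar R :=
  pushforward (lebesgue_measure \x mu)%E (@cons_point n).

Let nu := measure_function_pushforward__canonical__measure_function_Measure
  (lebesgue_measure \x mu)%E (@measurable_cons_point n).

Let lebesgue_cons0 : lebesgue_cons set0 = 0%E.
Proof. exact: (measure0 nu). Qed.

Let lebesgue_cons_ge0 A : (0 <= lebesgue_cons A)%E.
Proof. exact: (measure_ge0 nu). Qed.

Let lebesgue_cons_sigma_additive : semi_sigma_additive lebesgue_cons.
Proof. exact: (@measure_semi_sigma_additive _ _ _ nu). Qed.

HB.instance Definition _ := isMeasure.Build _ _ _ lebesgue_cons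
  lebesgue_cons0 lebesgue_cons_ge0 lebesgue_cons_sigma_additive.

Let lebesgue_cons_sigma_finite : sigma_finite setT lebesgue_cons.
Proof.
have /sigma_finiteP[F [TF ndF Foo]] := sigma_finiteT (@lebesgue_measure R).
have /sigma_finiteP[G [TG ndG Goo]] := sigma_finiteT mu.
pose unc (x : point R n.+1) : measurableTypeR R * point R n :=
  (thead x, [tuple of behead x]).
have mu_ : measurable_fun setT unc.
  apply/measurable_fun_pair => /=; first exact: measurable_tnth.
  exact: measurable_behead.
have cK : cancel (@cons_point n) unc.
  by move=> [a t]; rewrite /unc /cons_point theadE; congr pair; exact/val_inj.
exists (fun k => unc @^-1` (F k `*` G k)).
  apply/seteqP; split=> // x _.
  have [i _ Fi] : (\bigcup_k F k) (unc x).1 by rewrite -TF.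
  have [j _ Gj] : (\bigcup_k G k) (unc x).2 by rewrite -TG.
  exists (maxn i j) => //; split.
    by move: Fi; exact/subsetPset/ndF/leq_maxl.
  by move: Gj; exact/subsetPset/ndG/leq_maxr.
move=> k; have [? ?] := Foo k; have [? ?] := Goo k; split.
  by rewrite -[X in measurable X]setTI; apply: mu_ => //; exact: measurableX.
rewrite /lebesgue_cons /pushforward -comp_preimage.
rewrite (_ : unc \o _ = id); last by apply/funext => p /=; rewrite cK.
by rewrite preimage_id product_measure1E// lte_mul_pinfty// ge0_fin_numE.
Qed.

HB.instance Definition _ := Measure_isSigmaFinite.Build _ _ _ lebesgue_cons
  lebesgue_cons_sigma_finite.

End Step.

Fixpoint lebesgue_point n : {sigma_finite_measure set (point R n) -> \bar R} :=
  match n with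
  | 0 => dirac [tuple]
  | n'.+1 => lebesgue_cons (lebesgue_point n')
  end.

(* This property determines a sigma-finite measure on the Borel sets of R^n. *)
Lemma lebesgue_point_box n (X : 'I_n -> set (measurableTypeR R)) :
  (forall j, measurable (X j)) ->
  lebesgue_point n [set x | forall j, X j (tnth x j)]
    = (\prod_(j < n) lebesgue_measure (X j))%E.
Proof.
elim: n X => [|n IHn] X mX.
  rewrite big_ord0 /= diracE mem_set //; by case.
rewrite big_ord_recl -(IHn (fun j => X (lift ord0 j))) //.
rewrite /= -[RHS]product_measure1E //.
  rewrite /lebesgue_cons /pushforward; congr product_measure1.
  apply/seteqP; split=> -[a t] /=.
    move=> H; split; first exact: (H ord0).
    by move=> j; have := H (lift ord0 j); rewrite tnthS.
  move=> [Ha Ht] j; have [j'|] := unliftP ord0 j; last by move=> ->.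
  by move=> ->; rewrite tnthS.
rewrite (_ : mkset _ = \bigcap_(j in setT)
    ((@tnth n (measurableTypeR R))^~ j @^-1` X (lift ord0 j))).
  apply: fin_bigcap_measurable => // j _.
  by rewrite -[X in measurable X]setTI; apply: measurable_tnth.
by apply/seteqP; split=> x /= H j; [move=> _|]; exact: H.
Qed.

End LebesgueTuple.

Section Clipping.
Context {R : realType} {n m : nat}.
Implicit Types (A : 'M[R]_(n, m)) (r : 'I_m -> R) (x v : point R n).

Definition coord x (j : 'I_n) : R := tnth x j.

Definition g A r (i : 'I_m) x : R := \sum_(j < n) A j i * coord x j + r i.

Definition nonconstant (f : point R n -> R) := exists x y, f x <> f y.

Definition hyperplane A r (i : 'I_m) : set (point R n) :=
  [set x | g A r i x = 0].

Definition halfspace A r (i : 'I_m) : set (point R n) :=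
  [set x | 0 <= g A r i x].

Definition polyhedron A r : set (point R n) :=
  \bigcap_(i in [set: 'I_m]) halfspace A r i.

Definition cube : set (point R n) := [set x | forall j, 0 <= coord x j <= 1].

Definition zeros v : {set 'I_n} := [set j | coord v j == 0]%SET.
Definition ones v : {set 'I_n} := [set j | coord v j == 1]%SET.
Definition stars v : {set 'I_n} :=
  [set j | (coord v j != 0) && (coord v j != 1)]%SET.
Definition bullets v : {set 'I_n} := (zeros v :|: ones v)%SET.

(* The index is an integer so that [skeleton (-1)] makes sense; it is empty. *)
Definition skeleton (d : int) : set (point R n) :=
  [set v | cube v /\ #|stars v|%:Z = d].

(* The minor of A on rows J and columns K, both taken in the order listed; it is
   only meaningful when [size J = size K], and then the default 0 is never read.
   An index set S is passed as [enum S], which lists it in increasing order. *)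
Definition minor A (J : seq 'I_n) (K : seq 'I_m) : R :=
  \det (\matrix_(p < size J, q < size J)
          nth 0 [seq A (tnth (in_tuple J) p) k | k <- K] q).

End Clipping.

Arguments cube {R n}.
Arguments skeleton {R n} d.

(* There are m.+1 half-spaces, and the distinguished last one has index
   [ord_max]; subsets I of the other indices are sets with [ord_max \notin I]. *)
Section GoodClipping.
Context {R : realType} {n m : nat}.
Implicit Types (A : 'M[R]_(n, m.+1)) (r : 'I_m.+1 -> R) (I : {set 'I_m.+1}).

Definition H_ A r I : set (point R n) :=
  (\bigcap_(i in [set` I]) hyperplane A r i) `&` polyhedron A r
    `\` hyperplane A r ord_max.

Definition good_clipping_A A r : Prop :=
  forall I, ord_max \notin I ->
    skeleton (#|I|%:Z - 1) `&` H_ A r I = set0.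

Definition good_clipping_B A r : Prop :=
  forall I, ord_max \notin I ->
  forall v, (skeleton #|I|%:Z `&` H_ A r I) v ->
    (\prod_(t in I)
       minor A (enum (stars v)) (enum (ord_max |: (I :\ t))%SET))
    * (\prod_(t in bullets v)
         minor A (enum (t |: stars v)%SET) (enum (ord_max |: I)%SET)) != 0.

Definition vertex_term A r I (v : point R n) : R :=
  let AI := minor A (enum (stars v)) (enum I) in
  ((-1) ^+ (#|zeros v| + (#|I| * (#|I| - 1)) %/ 2 + n * #|I|)
     * (g A r ord_max v * AI) ^+ n)
  / (n`!%:R * `|AI|
     * (\prod_(t in I)
          minor A (enum (stars v)) (enum (I :\ t)%SET ++ [:: ord_max]))
     * (\prod_(t in bullets v)
          minor A (enum (stars v) ++ [:: t]) (ord_max :: enum I))).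

End GoodClipping.

(* Main.v *)
Require Import Defs.
From HB Require Import structures.
From mathcomp Require Import all_boot all_order all_algebra.
From mathcomp Require Import all_classical all_reals all_analysis.
From mathcomp Require Import perm measurable_realfun ring lra zify.
Set Implicit Arguments.
Unset Strict Implicit.
Unset Printing Implicit Defensive.
Import Order.TTheory GRing.Theory Num.Theory.
Import numFieldNormedType.Exports.
Local Open Scope classical_set_scope.
Local Open Scope ring_scope.

(** The formula is an instance of Lawrence's vertex formula for the volume of a
    simple polyhedron [P = {h_i >= 0 for all i, g >= 0}].  Let [v] be a vertex
    of [P] with [g v > 0], let [c_1, .., c_n] be the normals of the constraints
    that are tight there, and write the gradient of [g] as [sum_p w_p c_p].  Then
    [v] contributes [g v ^ n / (n! |det c| prod_p (- w_p))], which up to sign is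
    the volume of the simplex cut out of the cone at [v] by [g = 0].

    The proof is the divergence theorem, iterated.  To make the induction on the
    dimension work it is stated for the integrals of [g ^ k / k!] over [P]
    ([integral_polyhedron]).  Choose a coordinate [j] in which [g] has slope
    [a_j <> 0].  Integrating along that coordinate turns the integral of
    [g ^ k / k!] over [P] into a signed sum, over the facets of [P], of the
    integrals of [g ^ k.+1 / k.+1!] over the facets ([integral_facets]); the
    facet [g = 0] does not contribute because the primitive vanishes on it.
    Forgetting the coordinate [j] identifies each facet with a polyhedron of the
    same kind in one dimension less, and Gaussian elimination relates the
    contribution of a vertex in the facet to its contribution in [P]
    ([facet_vertex_volume]): they differ by the factor [w_p c_pj / a_j], where
    [p] is the constraint that defines the facet.  Summed over the facets
    through a vertex these factors give [1], since [sum_p w_p c_pj = a_j].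

    For the clipped cube the constraints are [x_t >= 0], [x_t <= 1] and
    [g_i >= 0] for [i] other than the last index, whose [g] is the objective.
    Condition (A) says that at most [n] constraints are tight at a point with
    [g > 0].  That their normals are independent follows, because from any such
    point one can slide to a vertex without losing a tight constraint
    ([exists_vertex], [active_independent]).  Condition (B) says that no [w_p]
    vanishes ([weights_neq0]).  A vertex with tight constraints [I] among the
    [g_i] lies in the interior of a face of the cube of dimension [#|I|], so the
    vertices are indexed as in the double sum ([skeleton_H_tight]).  Finally the
    [w_p] solve a linear system whose matrix is that of the minor [A_*^I], and
    Cramer's rule expresses them by the minors of the formula
    ([prod_minor_replace], [prod_minor_border]). *)

(* Unqualified, [point] is the base point of a pointed type. *)
Local Notation euclid R n := (Defs.point R n).

(** * Fubini's theorem along an arbitrary coordinate *)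

Section CoordinateFubini.
Context {R : realType}.

Definition insert_coord n (j : 'I_n.+1) (s : R) (t : euclid R n) : euclid R n.+1 :=
  [tuple if unlift j i is Some k then tnth t k else s | i < n.+1].

Lemma tnth_insert_same n (j : 'I_n.+1) s (t : euclid R n) :
  tnth (insert_coord j s t) j = s.
Proof. by rewrite tnth_mktuple unlift_none. Qed.

Lemma tnth_insert_lift n (j : 'I_n.+1) s (t : euclid R n) k :
  tnth (insert_coord j s t) (lift j k) = tnth t k.
Proof. by rewrite tnth_mktuple liftK. Qed.

Lemma insert_coord0 n s (t : euclid R n) :
  insert_coord ord0 s t = cons_point (s, t).
Proof.
apply: eq_from_tnth => i; case: (unliftP ord0 i) => [k|] ->.
  by rewrite tnth_insert_lift tnthS.
by rewrite tnth_insert_same.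
Qed.

Lemma insert_coordS n (j : 'I_n.+1) s u (t : euclid R n) :
  insert_coord (lift ord0 j) s (cons_point (u, t))
  = cons_point (u, insert_coord j s t).
Proof.
apply: eq_from_tnth => i.
rewrite tnth_mktuple.
case: (unliftP ord0 i) => [k|] ->; last first.
  rewrite /cons_point /=.
  case: unliftP => [k|/(congr1 val)] //.
  case: (unliftP ord0 k) => [k'|] ->; last by rewrite !tnth0.
  by move/(congr1 val); rewrite /= /bump /= !add1n addnS.
rewrite [RHS]tnthS [RHS]tnth_mktuple.
case: (unliftP j k) => [k'|] ->; last by rewrite unlift_none.
suff -> : lift ord0 (lift j k') = lift (lift ord0 j) (lift ord0 k').
  by rewrite liftK tnthS.
by apply: val_inj; rewrite /= /bump /= !add1n ltnS addnS.
Qed.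

Lemma measurable_insert_coord n (j : 'I_n.+1) :
  measurable_fun setT
    (fun p : measurableTypeR R * euclid R n => insert_coord j p.1 p.2).
Proof.
apply/measurable_fun_tnthP => i.
rewrite (_ : _ \o _ = fun p : measurableTypeR R * euclid R n =>
   if unlift j i is Some k then tnth p.2 k else p.1); last first.
  by apply/funext => p /=; rewrite tnth_mktuple.
case: (unlift j i) => [k|]; last exact: measurable_fst.
apply: (measurableT_comp (f := fun t : euclid R n => tnth t k)) => //.
exact: measurable_tnth.
Qed.

Lemma integral_cons_point n (f : euclid R n.+1 -> \bar R) :
  measurable_fun setT f -> (forall x, 0 <= f x)%E ->
  (\int[lebesgue_point n.+1]_x f x
   = \int[lebesgue_measure]_s \int[lebesgue_point n]_t f (cons_point (s, t)))%E.
Proof.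
move=> mf f0.
transitivity (\int[(lebesgue_measure \x lebesgue_point n)%E]_p (f (cons_point p)))%E.
  rewrite (ge0_integral_pushforward (@measurable_cons_point R n)) //=.
by rewrite fubini_tonelli1 //=; apply: measurableT_comp => //; exact: measurable_cons_point.
Qed.

Lemma integral_insert_coord0 n (f : euclid R n.+1 -> \bar R) :
  measurable_fun setT f -> (forall x, 0 <= f x)%E ->
  (\int[lebesgue_point n.+1]_x f x
   = \int[lebesgue_point n]_t \int[lebesgue_measure]_s f (insert_coord ord0 s t))%E.
Proof.
move=> mf f0; rewrite integral_cons_point //.
rewrite (@fubini_tonelli _ _ _ _ _ _ _ (fun p => f (cons_point p))) //=; last first.
  by apply: measurableT_comp => //; exact: measurable_cons_point.
by under eq_integral do under eq_integral do rewrite -insert_coord0.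
Qed.

(** Slicing along an arbitrary coordinate: the product measure peels off the
    coordinates in order, so coordinate [j] is reached by swapping it past the
    [j] earlier ones with Tonelli's theorem. *)
Lemma integral_insert_coord n (j : 'I_n.+1) (f : euclid R n.+1 -> \bar R) :
  measurable_fun setT f -> (forall x, 0 <= f x)%E ->
  (\int[lebesgue_point n.+1]_x f x
   = \int[lebesgue_point n]_t \int[lebesgue_measure]_s f (insert_coord j s t))%E.
Proof.
elim: n j f => [|n IHn] j f mf f0.
  by rewrite ord1; exact: integral_insert_coord0.
case: (unliftP ord0 j) => [j'|] ->; last exact: integral_insert_coord0.
have mG : measurable_fun setT (fun t : euclid R n.+1 =>
    \int[lebesgue_measure]_s f (insert_coord (lift ord0 j') s t))%E.
  apply: (measurable_fun_fubini_tonelli_G (m1 := lebesgue_measure)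
    (fun p : measurableTypeR R * euclid R n.+1 =>
       f (insert_coord (lift ord0 j') p.1 p.2))) => //.
  by apply: measurableT_comp => //; exact: measurable_insert_coord.
rewrite integral_cons_point // integral_cons_point //; last first.
  by move=> x; apply: integral_ge0.
apply: eq_integral => s _.
rewrite (IHn j'); last by [].
  by apply: eq_integral => t _; apply: eq_integral => u _; rewrite insert_coordS.
apply: measurableT_comp => //.
apply: (measurableT_comp (@measurable_cons_point R n.+1)).
exact: pair1_measurable.
Qed.

End CoordinateFubini.

(** * Affine functions and hyperplanes *)

Section Affine.
Context {R : realType}.

Definition affine n (c : 'rV[R]_n) (d : R) (x : euclid R n) : R :=
  \sum_j c 0 j * tnth x j + d.

Lemma measurable_affine n (c : 'rV[R]_n) d : measurable_fun setT (affine c d).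
Proof.
apply: measurable_funD; last exact: measurable_cst.
apply: measurable_sum => j.
apply: measurable_funM; first exact: measurable_cst.
exact: (measurable_tnth (T := measurableTypeR R)).
Qed.

Lemma affine_insert n (c : 'rV[R]_n.+1) d (j : 'I_n.+1) s (t : euclid R n) :
  affine c d (insert_coord j s t) = affine (col' j c) (c 0 j * s + d) t.
Proof.
rewrite /affine (bigD1_ord j) //= tnth_insert_same.
under eq_bigr do rewrite tnth_insert_lift.
under [in RHS]eq_bigr do rewrite mxE.
by rewrite addrA (addrC (c 0 j * s)).
Qed.

(** A line in a coordinate direction in which the function is not constant
    meets its zero set in a single point. *)
Lemma hyperplane_null n (c : 'rV[R]_n) d : c != 0 ->
  lebesgue_point n [set x | affine c d x = 0] = 0%E.
Proof.
case: n c => [|n] c c0; first by rewrite [c]thinmx0 eqxx in c0.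
have [j cj] : exists j, c 0 j != 0 by apply/rV0Pn.
have mH : measurable [set x | affine c d x = 0].
  rewrite (_ : mkset _ = affine c d @^-1` [set 0]) //.
  rewrite -[X in measurable X]setTI.
  exact: measurable_affine.
set H := mkset _ in mH *.
have <- : (\int[lebesgue_point n.+1]_x (\1_H x)%:E)%E = lebesgue_point n.+1 H.
  by rewrite integral_indic ?setIT.
rewrite (integral_insert_coord j) //; last first.
  by apply/measurable_EFinP; exact: measurable_indic.
under eq_integral => t _.
  rewrite (_ : (\int[_]_s _)%E = 0%E) //; last first.
  pose s0 := - affine (col' j c) d t / c 0 j.
  rewrite -[RHS](lebesgue_measure_set1 s0) -[in RHS](setIT [set s0]).
  rewrite -integral_indic //.
  apply: eq_integral => s _; congr (_%:E); rewrite !indicE; congr ((nat_of_bool _)%:R).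
  apply/idP/idP; rewrite !inE /H /s0 /= affine_insert /affine => Hs.
    by apply: (mulfI cj); rewrite [RHS]mulrC divfK //; lra.
  by rewrite Hs [_ * (_ / _)]mulrC divfK //; lra.
over.
exact: integral0.
Qed.

End Affine.

(** * Integration over a segment cut out by affine inequalities *)

Section Line.
Context {R : realType}.

(** Normalised so that [divpow k.+1] is the primitive of [divpow k] that
    vanishes at [0]. *)
Definition divpow k (y : R) : R := y ^+ k / k`!%:R.

Lemma divpowS0 k : divpow k.+1 0 = 0.
Proof. by rewrite /divpow expr0n mul0r. Qed.

Lemma integral_divpow_affine k (a b lo hi : R) : a != 0 -> lo <= hi ->
  (\int[lebesgue_measure]_(s in `[lo, hi]) (divpow k (a * s + b))%:E
   = ((divpow k.+1 (a * hi + b) - divpow k.+1 (a * lo + b)) / a)%:E)%E.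
Proof.
move=> a0; rewrite le_eqVlt => /predU1P[<-|lohi].
  by rewrite subrr mul0r set_itv1 integral_set1.
pose p i : {poly R} := i`!%:R^-1 *: (a *: 'X + b%:P) ^+ i.
have pE i s : (p i).[s] = divpow i (a * s + b).
  by rewrite /p /divpow !hornerE mulrC.
have dp : (a^-1 *: p k.+1)^`() = p k.
  rewrite /p !derivZ deriv_exp derivD derivZ derivX derivC addr0 /=.
  rewrite alg_polyC mul_polyC -[_ *+ k.+1]scaler_nat !scalerA; congr (_ *: _).
  have k0 : k`!%:R != 0 :> R by rewrite pnatr_eq0 -lt0n fact_gt0.
  have k1 : k.+1%:R != 0 :> R by rewrite pnatr_eq0.
  by rewrite factS natrM; field; apply/and3P.
under eq_integral do rewrite -pE.
rewrite (@continuous_FTC2 _ _ (horner (a^-1 *: p k.+1))) //.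
- by rewrite -EFinB hornerZ pE hornerZ pE -mulrBr mulrC.
- exact/continuous_subspaceT/continuous_horner.
- split.
  + by move=> x _; exact: derivable_horner.
  + exact/cvg_at_right_filter/continuous_horner.
  + exact/cvg_at_left_filter/continuous_horner.
- by move=> x _; rewrite derive1E derive_val dp.
Qed.

(** The lower end of the segment is the largest of the points at which a
    constraint of positive slope becomes tight; without such a constraint the
    segment would be unbounded below. *)
Lemma line_lower_end (U : finType) (beta alpha : U -> R) (s0 M : R) :
  (forall o, 0 <= beta o * s0 + alpha o) ->
  (forall s, (forall o, 0 <= beta o * s + alpha o) -> `|s| <= M) ->
  exists o, [/\ 0 < beta o,
    (forall o', 0 <= beta o' * (- alpha o / beta o) + alpha o') &
    forall s, (forall o', 0 <= beta o' * s + alpha o') -> - alpha o / beta o <= s].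
Proof.
move=> s0P bnd.
have [ o0 o0P] : exists o, 0 < beta o.
  apply: contrapT => /forallNP noP.
  have : `|s0 - (`|s0| + M + 1)| <= M.
    apply: (bnd) => o; have := s0P o; have bo : beta o <= 0 by rewrite leNgt; apply/negP/noP.
    have : 0 <= - beta o * (`|s0| + M + 1).
      rewrite mulr_ge0 ?oppr_ge0 // !addr_ge0 //.
      by apply: le_trans (bnd _ s0P); exact: normr_ge0.
    by lra.
  rewrite ler_norml => /andP[+ _]; have := ler_norm s0; lra.
have hitE o : 0 < beta o -> beta o * (- alpha o / beta o) = - alpha o.
  by move=> bo; rewrite mulrC divfK ?gt_eqF.
have hit_le o : 0 < beta o -> forall s,
    (forall o', 0 <= beta o' * s + alpha o') -> - alpha o / beta o <= s.
  by move=> bo s /(_ o) sP; rewrite ler_pdivrMr //; lra.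
case: (@arg_maxP _ _ _ o0 (fun o => 0 < beta o) (fun o => - alpha o / beta o) o0P) => o bo omax.
exists o; split => //; last exact: hit_le.
move=> o'; have [bo'|bo'] := ltP 0 (beta o').
  have H : - alpha o' / beta o' <= - alpha o / beta o by exact: omax.
  by rewrite ler_pdivrMr // in H; lra.
have := s0P o'; have := hit_le _ bo _ s0P; nra.
Qed.

(** Constraints that become tight at the same end of a segment would count that
    end once each; this is excluded except where the value is [0] anyway. *)
Lemma sum_unique_hit (I : finType) (V : nmodType) (C : pred I) (F : I -> V) y :
  (forall i, C i -> F i = y) -> (exists i, C i) \/ y = 0 ->
  (forall i l, i != l -> C i -> C l -> y = 0) ->
  \sum_(i | C i) F i = y.
Proof.
move=> FC ex uniq; have [y0|y0] := eqVneq y 0.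
  by rewrite big1 // => i /FC ->.
case: ex => [[i Ci]|/eqP]; last by rewrite (negPf y0).
rewrite (bigD1 i) //= big1 ?addr0 ?FC // => l /andP[Cl li].
by rewrite (uniq _ _ li Cl Ci) eqxx in y0.
Qed.

(** On a line, a bounded set cut out by affine inequalities is an interval, and
    the fundamental theorem of calculus evaluates the integral at its two ends:
    a constraint of positive slope can only be tight at the lower one, a
    constraint of negative slope only at the upper one.  The objective itself
    vanishes when it is what cuts, so its end does not contribute. *)
Lemma integral_line (T : finType) (beta alpha : T -> R) (a b M : R) k
    (feas := fun s => [forall i, 0 <= beta i * s + alpha i] && (0 <= a * s + b))
    (hit := fun i => - alpha i / beta i) :
  a != 0 ->
  (forall s, feas s -> `|s| <= M) ->
  (forall i l, i != l -> beta i != 0 -> beta l != 0 -> hit i = hit l ->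
     feas (hit i) -> a * hit i + b = 0) ->
  (\int[lebesgue_measure]_(s in [set s | feas s]) (divpow k (a * s + b))%:E
   = (\sum_(i | (beta i != 0) && feas (hit i))
        - Num.sg (beta i) / a * divpow k.+1 (a * hit i + b))%:E)%E.
Proof.
move=> a0 bnd sep.
(* The objective is one more constraint, with index [None]. *)
pose be (o : option T) := if o is Some i then beta i else a.
pose al (o : option T) := if o is Some i then alpha i else b.
have feasP s : reflect (forall o, 0 <= be o * s + al o) (feas s).
  apply: (iffP andP) => [[/forallP fs gs]|fs].
    by case=> [i|]; [exact: fs|exact: gs].
  by split; [apply/forallP => i; exact: (fs (Some i))|exact: (fs None)].
have [[s0 fs0]|nofeas] := pselect (exists s, feas s); last first.
  rewrite big1 => [|i /andP[_ fi]]; last by case: nofeas; exists (hit i).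
  rewrite (_ : mkset _ = set0) ?integral_set0 //.
  by apply/seteqP; split=> // s fs; apply: nofeas; exists s.
have [|s /feasP|lo [blo /feasP flo lole]] := @line_lower_end _ be al s0 M.
- exact/feasP.
- exact: bnd.
have [| |hi [bhi fhi hige]] :=
  @line_lower_end _ (fun o => - be o) al (- s0) M.
- by move=> o; rewrite mulrNN; exact/feasP.
- move=> s fs; rewrite -normrN; apply: bnd; apply/feasP => o.
  by have := fs o; rewrite mulNr mulrN.
have {}fhi : feas (- al hi / be hi).
  by apply/feasP => o; have := fhi o; rewrite invrN !mulrN mulNr opprK.
have {}hige s : feas s -> s <= - al hi / be hi.
  move=> fs; rewrite -lerN2; have := hige (- s); rewrite invrN mulrN; apply.
  by move=> o; rewrite mulrNN; exact/feasP.
rewrite oppr_gt0 in bhi.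
set L := - al lo / be lo in lole flo; set H := - al hi / be hi in hige fhi.
have {}lole s : feas s -> L <= s by move/feasP/lole.
have LH : L <= H by exact: lole.
rewrite (_ : mkset _ = `[L, H]%classic); last first.
  apply/seteqP; split=> s /=; rewrite in_itv /=.
    by move=> fs; rewrite lole // hige.
  move=> /andP[Ls sH]; apply/feasP => o.
  have /feasP/(_ o) := flo; have /feasP/(_ o) := fhi.
  by have [bo|bo] := leP 0 (be o); nra.
rewrite integral_divpow_affine //; congr (_%:E).
have hitP i : beta i != 0 -> beta i * hit i + alpha i = 0.
  by move=> bi; rewrite /hit mulrC divfK // addNr.
have tight o (s : R) : s = - al o / be o -> be o != 0 -> be o * s + al o = 0.
  by move=> -> bo; rewrite mulrC divfK // addNr.
have lo0 : be lo != 0 by rewrite gt_eqF.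
have hi0 : be hi != 0 by rewrite lt_eqF.
have hitL i : (0 < beta i) && feas (hit i) -> hit i = L.
  move=> /andP[bi fi]; apply/eqP; rewrite eq_le lole // andbT.
  have /feasP/(_ (Some i)) /= := flo; have := hitP i; rewrite gt_eqF // => /(_ isT).
  by nra.
have hitH i : (beta i < 0) && feas (hit i) -> hit i = H.
  move=> /andP[bi fi]; apply/eqP; rewrite eq_le hige //=.
  have /feasP/(_ (Some i)) /= := fhi; have := hitP i; rewrite lt_eqF // => /(_ isT).
  by nra.
pose G s := divpow k.+1 (a * s + b).
have sumL : \sum_(i | (0 < beta i) && feas (hit i)) G (hit i) = G L.
  apply: sum_unique_hit => [i /hitL -> //||i l il].
    case Elo: lo => [i|].
      by left; exists i; move: blo flo; rewrite /L Elo /= => -> ->.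
    right; rewrite /G; have := tight lo L erefl lo0.
    by rewrite Elo /= => ->; rewrite divpowS0.
  move=> /[dup] Ci /hitL hi' /[dup] Cl /hitL hl'.
  case/andP: Ci => bi fi; case/andP: Cl => bl fl.
  by rewrite /G -hi' (sep i l) ?divpowS0 ?hi' ?hl' ?gt_eqF.
have sumH : \sum_(i | (beta i < 0) && feas (hit i)) G (hit i) = G H.
  apply: sum_unique_hit => [i /hitH -> //||i l il].
    case Ehi: hi => [i|].
      by left; exists i; move: bhi fhi; rewrite /H Ehi /= => -> ->.
    right; rewrite /G; have := tight hi H erefl hi0.
    by rewrite Ehi /= => ->; rewrite divpowS0.
  move=> /[dup] Ci /hitH hi' /[dup] Cl /hitH hl'.
  case/andP: Ci => bi fi; case/andP: Cl => bl fl.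
  by rewrite /G -hi' (sep i l) ?divpowS0 ?hi' ?hl' ?lt_eqF.
rewrite -/(G H) -/(G L) -sumL -sumH mulrBl !mulr_suml.
rewrite !(big_mkcond (fun i => _ && feas _)) -sumrB.
apply: eq_bigr => i _; case: (feas _); rewrite ?andbF ?subrr // !andbT.
rewrite -/(G _); have [bi|bi|->] := ltgtP (beta i) 0.
- by rewrite ltr0_sg // subr0 opprK div1r mulrC.
- by rewrite gtr0_sg // sub0r mulN1r mulNr mulrC.
- by rewrite subrr.
Qed.

End Line.

(** * Vertices and their contributions *)

Section Vertices.
Context {R : realType} {T : finType} {n : nat}.
Implicit Types (c : T -> 'rV[R]_n) (d : T -> R) (a : 'rV[R]_n) (b : R).
Implicit Types (f : {ffun 'I_n -> T}) (x : euclid R n).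

Definition inside c d a b x : bool :=
  [forall i, 0 <= affine (c i) (d i) x] && (0 <= affine a b x).

Lemma insideP c d a b x :
  reflect ((forall i, 0 <= affine (c i) (d i) x) /\ 0 <= affine a b x)
          (inside c d a b x).
Proof. by apply: (iffP andP) => -[/forallP]. Qed.

Definition normals c f : 'M[R]_n := \matrix_p c (f p).

(** The intersection point of the [n] hyperplanes listed by [f]; meaningful only
    when their normals are independent, which [cuts_vertex] includes. *)
Definition vertex c d f : euclid R n :=
  [tuple (invmx (normals c f) *m \col_p - d (f p)) j 0 | j < n].

(** The coordinates of the gradient of the objective in the basis of normals:
    the slope of the objective along the edge that leaves the [p]-th hyperplane,
    per unit of the [p]-th constraint. *)
Definition weights c a f : 'rV[R]_n := a *m invmx (normals c f).

Definition cuts_vertex c d a b f : bool :=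
  [&& normals c f \in unitmx, inside c d a b (vertex c d f)
    & 0 < affine a b (vertex c d f)].

(** For [k = 0], up to sign, the volume of the simplex bounded by the [n]
    hyperplanes and by the zero set of the objective: the edge leaving the
    [p]-th hyperplane reaches that set after the [p]-th constraint has changed
    by [- g v / w_p].  The sign counts the edges along which the objective
    increases and which are therefore followed backwards. *)
Definition vertex_volume c d a b k f : R :=
  if cuts_vertex c d a b f
  then divpow (n + k) (affine a b (vertex c d f))
       / (`|\det (normals c f)| * \prod_p - weights c a f 0 p)
  else 0.

Lemma affineE (u : 'rV[R]_n) e x :
  affine u e x = (u *m \col_j tnth x j) 0 0 + e.
Proof. by rewrite mxE /affine; congr (_ + _); apply: eq_bigr => j _; rewrite mxE. Qed.

Lemma normals_mulE c d f x :
  (forall p, affine (c (f p)) (d (f p)) x = 0) <->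
  normals c f *m \col_j tnth x j = \col_p - d (f p).
Proof.
have E p : (normals c f *m \col_j tnth x j) p 0 = (c (f p) *m \col_j tnth x j) 0 0.
  by rewrite !mxE; apply: eq_bigr => j _; rewrite !mxE.
split=> [x0|eqx p].
  apply/colP => p; rewrite E [RHS]mxE; have := x0 p; rewrite affineE.
  by move/eqP; rewrite addr_eq0 => /eqP.
by rewrite affineE -E eqx mxE addNr.
Qed.

Lemma col_vertex c d f :
  \col_j tnth (vertex c d f) j = invmx (normals c f) *m \col_p - d (f p).
Proof. by apply/colP => j; rewrite mxE tnth_mktuple. Qed.

Lemma affine_vertex c d f p : normals c f \in unitmx ->
  affine (c (f p)) (d (f p)) (vertex c d f) = 0.
Proof. by move=> cU; move: p; apply/normals_mulE; rewrite col_vertex mulKVmx. Qed.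

Lemma vertex_unique c d f x : normals c f \in unitmx ->
  (forall p, affine (c (f p)) (d (f p)) x = 0) -> vertex c d f = x.
Proof.
move=> cU /normals_mulE xE; apply: eq_from_tnth => j.
have /colP/(_ j) := col_vertex c d f.
by rewrite -xE mulKmx // !mxE.
Qed.

Lemma weights_sum c a f : normals c f \in unitmx ->
  \sum_p weights c a f 0 p *: c (f p) = a.
Proof.
move=> cU; rewrite -[RHS](mulmxKV cU) -/(weights c a f) mulmx_sum_row.
by apply: eq_bigr => p _; rewrite rowK.
Qed.

Lemma weights_unique c a f (w : 'rV[R]_n) : normals c f \in unitmx ->
  \sum_p w 0 p *: c (f p) = a -> weights c a f = w.
Proof.
move=> cU <-; rewrite /weights.
rewrite (_ : \sum_p _ = w *m normals c f) ?mulmxK //.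
by rewrite mulmx_sum_row; apply: eq_bigr => p _; rewrite rowK.
Qed.

Lemma vertex_volume_perm c d a b k f (s : 'S_n) (fs := [ffun p => f (s p)] : {ffun 'I_n -> T}) :
  vertex_volume c d a b k fs = vertex_volume c d a b k f /\
  (normals c f \in unitmx -> forall p, weights c a fs 0 p = weights c a f 0 (s p)).
Proof.
have rowsE : normals c fs = row_perm s (normals c f).
  by apply/matrixP => p q; rewrite !mxE ffunE.
have unitE : (normals c fs \in unitmx) = (normals c f \in unitmx).
  by rewrite rowsE row_permE unitmx_mul unitmx_perm.
have wE : normals c f \in unitmx -> forall p, weights c a fs 0 p = weights c a f 0 (s p).
  move=> cU p; rewrite (@weights_unique _ _ _ (\row_q weights c a f 0 (s q))) ?mxE ?unitE //.
  rewrite -[RHS](weights_sum a cU) [RHS](reindex_inj (@perm_inj _ s)) /=.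
  by apply: eq_bigr => q _; rewrite mxE ffunE.
split=> //; rewrite /vertex_volume /cuts_vertex unitE; case: ifP => [/and3P[cU xP gP]|]; last first.
  case cU: (_ \in unitmx) => //=.
  rewrite (@vertex_unique _ _ _ (vertex c d f)) ?unitE // => [->//|p].
  by rewrite ffunE affine_vertex.
have vE : vertex c d fs = vertex c d f.
  by apply: vertex_unique => [|p]; rewrite ?unitE // ffunE affine_vertex.
move: xP gP; rewrite vE cU => -> -> /=.
rewrite rowsE row_permE det_mulmx det_perm normrM normrX normrN1 expr1n mul1r.
congr (_ / (_ * _)); rewrite [RHS](reindex_inj (@perm_inj _ s)) /=.
by apply: eq_bigr => p _; rewrite wE.
Qed.

Lemma normals_inj c f : normals c f \in unitmx -> injective f.
Proof.
move=> fU p q fpq; apply/eqP/negPn/negP => pq.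
have E : delta_mx 0 p = delta_mx 0 q :> 'rV[R]_n.
  by rewrite -[LHS](mulmxK fU) -[RHS](mulmxK fU) -!rowE !rowK fpq.
move/matrixP/(_ 0 p)/eqP: E.
by rewrite !mxE !eqxx (negPf pq) oner_eq0.
Qed.

Lemma spanning_basis c (S : {set T}) :
  (forall u : 'rV[R]_n, (forall i, i \in S -> c i *m u^T = 0) -> u = 0) ->
  exists2 f : {ffun 'I_n -> T}, forall p, f p \in S & normals c f \in unitmx.
Proof.
move=> span; pose N : 'M[R]_(#|S|, n) := \matrix_p c (enum_val p).
have Nfull : row_full N.
  rewrite -cokermx_eq0; apply/eqP/trmx_inj; apply/row_matrixP => q.
  rewrite trmx0 row0; apply: span => i iS; rewrite tr_row trmxK.
  rewrite -[i](enum_rankK_in iS iS) -(rowK (fun p => c (enum_val p))) -/N.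
  by rewrite colE mulmxA -row_mul mulmx_coker row0 mul0mx.
pose f := [ffun p => enum_val (fullrankfun Nfull p)] : {ffun 'I_n -> T}.
exists f => [p|]; first by rewrite ffunE enum_valP.
rewrite -row_full_unit (_ : normals c f = rowsub (fullrankfun Nfull) N).
  by rewrite /row_full mxrank_fullrowsub.
by apply/matrixP => p q; rewrite !mxE ffunE.
Qed.

End Vertices.

(** * Existence of vertices *)

Section ExistsVertex.
Context {R : realType} {T : finType} {n : nat}.
Context (c : T -> 'rV[R]_n) (d : T -> R) (a : 'rV[R]_n) (b : R).
Implicit Types (x v : euclid R n) (u : 'rV[R]_n).

Definition active x : {set T} := [set i | affine (c i) (d i) x == 0]%SET.

Definition move_along x u (s : R) : euclid R n :=
  [tuple tnth x j + s * u 0 j | j < n].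

Lemma affine_move (e : 'rV[R]_n) (h : R) x u s :
  affine e h (move_along x u s) = affine e h x + s * (e *m u^T) 0 0.
Proof.
rewrite /affine mxE mulr_sumr addrAC -big_split /=; congr (_ + _).
by apply: eq_bigr => j _; rewrite !mxE tnth_mktuple; ring.
Qed.

(** As long as the tight normals do not span, there is a direction along which
    the tight constraints are constant and the objective does not decrease.
    Moving in it makes a further constraint tight, since the region is bounded;
    so a point with the most tight constraints is reached. *)
Lemma exists_vertex (M : R) x :
  (forall y, inside c d a b y -> forall j, `|tnth y j| <= M) ->
  inside c d a b x -> 0 < affine a b x ->
  exists v, [/\ inside c d a b v, 0 < affine a b v, active x \subset active v &
    forall u, (forall i, i \in active v -> c i *m u^T = 0) -> u = 0].
Proof.
move=> bnd; have [N] := ubnP (#|T| - #|active x|)%N.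
elim: N x => // N IHN x; rewrite ltnS => leN xP gx.
have [span|] := pselect (forall u, (forall i, i \in active x -> c i *m u^T = 0) -> u = 0).
  by exists x.
move=> /existsNP[u0 /not_implyP[u0x /eqP u0n0]].
(* One of the two orientations of [u0] does not decrease the objective. *)
have [u [ux un0 gu]] : exists u, [/\ forall i, i \in active x -> c i *m u^T = 0,
    u != 0 & 0 <= (a *m u^T) 0 0].
  have [g0|g0] := leP 0 ((a *m u0^T) 0 0); first by exists u0.
  have u0T : (- u0)^T = - u0^T by apply/colP => j; rewrite !mxE.
  exists (- u0); rewrite oppr_eq0 u0T mulmxN mxE oppr_ge0 ltW //; split=> // i ix.
  by rewrite mulmxN u0x // oppr0.
have /insideP[xP1 xP2] := xP.
have [i0 i0P] : exists i, (c i *m u^T) 0 0 < 0.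
  apply: contrapT => /forallNP noP.
  have /rV0Pn[j uj] := un0.
  pose s := (`|M| + `|tnth x j| + 1) / `|u 0 j|.
  have s0 : 0 <= s by rewrite divr_ge0 // !addr_ge0.
  have : inside c d a b (move_along x u s).
    apply/insideP; split=> [i|]; rewrite affine_move addr_ge0 // mulr_ge0 //.
    by rewrite leNgt; apply/negP/noP.
  move=> /bnd/(_ j); rewrite tnth_mktuple.
  have suE : `|s * u 0 j| = `|M| + `|tnth x j| + 1.
    by rewrite normrM (ger0_norm s0) /s divfK // normr_eq0.
  have := ler_norm M; have := ler_normB (tnth x j + s * u 0 j) (tnth x j).
  by rewrite addrAC subrr add0r suE; lra.
pose hit i := affine (c i) (d i) x / - (c i *m u^T) 0 0.
case: (@arg_minP _ _ _ i0 (fun i => (c i *m u^T) 0 0 < 0) hit i0P) => i ci imin.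
have hit0 : 0 <= hit i by rewrite divr_ge0 // oppr_ge0 ltW.
pose y := move_along x u (hit i).
have gy : 0 < affine a b y.
  by rewrite affine_move (lt_le_trans gx) // lerDl mulr_ge0.
have yP : inside c d a b y.
  apply/insideP; split=> [l|]; last exact: ltW.
  rewrite affine_move; have [cl|cl] := ltP ((c l *m u^T) 0 0) 0; last first.
    by rewrite addr_ge0 // mulr_ge0.
  have hl : hit i <= hit l by exact: imin.
  by rewrite {2}/hit ler_pdivlMr ?oppr_gt0 // in hl; lra.
have xy : active x \subset active y.
  apply/fintype.subsetP => l lx; rewrite inE affine_move ux // mxE mulr0 addr0.
  by rewrite inE in lx.
have iy : i \in active y.
  rewrite inE affine_move /hit invrN; apply/eqP; field.
  by rewrite lt_eqF.
have ix : i \notin active x.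
  by apply/negP => /ux ci0; rewrite ci0 mxE ltxx in ci.
have [||//|v [vP gv yv span]] := IHN y.
- have lt_xy : (#|active x| < #|active y|)%N.
    by apply: proper_card; rewrite properE xy; apply/fintype.subsetPn; exists i.
  apply: leq_trans leN; apply: ltn_sub2l => //; apply: leq_trans lt_xy _.
  exact: max_card.
- exact: yP.
- by exists v; split=> //; exact: fintype.subset_trans xy yv.
Qed.

(** When at most [n] constraints are ever tight together, linear independence is
    automatic: sliding to a vertex only adds tight constraints, a vertex
    needs [n] independent ones, and there is no room for more than [n]. *)
Lemma active_independent (M : R) x (lam : T -> R) :
  (forall y, inside c d a b y -> forall j, `|tnth y j| <= M) ->
  (forall y, inside c d a b y -> 0 < affine a b y -> (#|active y| <= n)%N) ->
  inside c d a b x -> 0 < affine a b x ->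
  (forall i, lam i != 0 -> affine (c i) (d i) x = 0) ->
  \sum_i lam i *: c i = 0 -> forall i, lam i = 0.
Proof.
move=> bnd card xP gx lamx lam0 i.
have [v [vP gv xv span]] := exists_vertex bnd xP gx.
have [f fv fU] := spanning_basis span.
have finj := normals_inj fU.
have imf : [set f p | p in 'I_n]%SET = active v.
  apply/eqP; rewrite eqEcard card_imset // card_ord card // andbT.
  by apply/fintype.subsetP => _ /imsetP[p _ ->].
have lamv l : lam l != 0 -> l \in active v.
  by move=> /lamx lx; apply: (fintype.subsetP xv); rewrite inE lx.
apply/eqP/negPn/negP => li0.
have : i \in active v by exact: lamv.
rewrite -imf => /imsetP[p _ ip].
have E : (\row_q lam (f q)) *m normals c f = 0.
  rewrite mulmx_sum_row -[RHS]lam0 (bigID (mem (active v))) /= [X in _ + X]big1 ?addr0.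
    rewrite -imf big_imset /=; last by move=> ? ? _ _; exact: finj.
    by apply: eq_bigr => q _; rewrite mxE rowK.
  move=> l lv; suff /eqP -> : lam l == 0 by rewrite scale0r.
  by apply: contraNT lv => /lamv.
have /eqP := congr1 (mulmx^~ (invmx (normals c f))) E.
rewrite mulmxK // mul0mx => /eqP/rowP/(_ p); rewrite !mxE -ip => lp0.
by rewrite lp0 eqxx in li0.
Qed.

End ExistsVertex.

(** * Projection of a facet along a coordinate *)

(** The numerical core of [facet_vertex_volume]: [c] is the pivot, [w] the
    weight of the eliminated constraint, [e] the slope of the objective. *)
Lemma cancel_pivot (R : realType) (X e w c D P : R) :
  e != 0 -> c != 0 -> w != 0 -> D != 0 ->
  - Num.sg c / e * (X / (D * P)) = X / (`|c| * D * (- w * P)) * (w * c / e).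
Proof.
move=> e0 c0 w0 D0; have [->|P0] := eqVneq P 0.
  by rewrite !mulr0 invr0 !mulr0 mul0r.
have := c0; rewrite neq_lt => /orP[] c1.
  by rewrite ltr0_sg // ltr0_norm //; field; rewrite e0 w0 P0 D0 c0.
by rewrite gtr0_sg // gtr0_norm //; field; rewrite e0 w0 P0 D0 c0.
Qed.

Section Facet.
Context {R : realType} {T : finType} {n : nat}.
Context (c : T -> 'rV[R]_n.+1) (d : T -> R) (a : 'rV[R]_n.+1) (b : R).
Context (j : 'I_n.+1) (i : T).
Implicit Types (u : 'rV[R]_n.+1) (e : R) (t : euclid R n).

Definition facet_hit t : R := - affine (col' j (c i)) (d i) t / c i 0 j.
(** The hyperplane of constraint [i] as a graph over the coordinates other than
    [j]. *)
Definition facet_lift t : euclid R n.+1 := insert_coord j (facet_hit t) t.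

Definition facet_normal u : 'rV[R]_n := col' j (u - (u 0 j / c i 0 j) *: c i).
Definition facet_offset u e : R := e - u 0 j / c i 0 j * d i.

Definition facet_normals l : 'rV[R]_n := facet_normal (c l).
(** Constraint [i] vanishes on its own hyperplane.  Adding [1] to it keeps the
    index type unchanged while making the constraint trivial: its normal is
    [0], it always holds, and it is never tight. *)
Definition facet_offsets l : R := facet_offset (c l) (d l) + (l == i)%:R.

Hypothesis cij : c i 0 j != 0.

Lemma affine_facet u e t :
  affine (facet_normal u) (facet_offset u e) t = affine u e (facet_lift t).
Proof.
rewrite affine_insert /facet_hit /affine /facet_offset /facet_normal.
rewrite (eq_bigr (fun k => col' j u 0 k * tnth t k
   - u 0 j / c i 0 j * (col' j (c i) 0 k * tnth t k))); last first.
  by move=> k _; rewrite !mxE; ring.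
by rewrite sumrB -mulr_sumr; field.
Qed.

Lemma affine_facet_lift t : affine (c i) (d i) (facet_lift t) = 0.
Proof.
rewrite affine_insert /facet_hit /affine; field => //.
Qed.

Lemma affine_facets l t :
  affine (facet_normals l) (facet_offsets l) t
  = affine (c l) (d l) (facet_lift t) + (l == i)%:R.
Proof. by rewrite -affine_facet /affine addrA. Qed.

Lemma inside_facet t :
  inside facet_normals facet_offsets (facet_normal a) (facet_offset a b) t
  = inside c d a b (facet_lift t).
Proof.
rewrite /inside affine_facet; congr andb; apply: eq_forallb => l.
rewrite affine_facets; case: eqP => [->|_]; last by rewrite addr0.
by rewrite affine_facet_lift add0r ler01 lexx.
Qed.

Lemma tnth_facet_lift t k : tnth (facet_lift t) (lift j k) = tnth t k.
Proof. exact: tnth_insert_lift. Qed.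

Lemma facet_normal_self : facet_normal (c i) = 0.
Proof. by rewrite /facet_normal divff // scale1r subrr raddf0. Qed.

Lemma facet_normal_sum (I : finType) (w : I -> R) (u : I -> 'rV[R]_n.+1) :
  facet_normal (\sum_l w l *: u l) = \sum_l w l *: facet_normal (u l).
Proof.
apply/rowP => k; rewrite !mxE !summxE !mulr_suml -sumrB.
by apply: eq_bigr => l _; rewrite !mxE; ring.
Qed.

Lemma facet_normal_inj u : facet_normal u = 0 -> u = (u 0 j / c i 0 j) *: c i.
Proof.
move=> /rowP u0; apply/rowP => k; have [l|] := unliftP j k => [->|->].
  by have := u0 l; rewrite !mxE => /eqP; rewrite subr_eq0 => /eqP.
by rewrite mxE divfK.
Qed.

(** A relation among the projected normals lifts to one among the original
    normals in which the normal of [i] absorbs the eliminated coordinate. *)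
Lemma facet_independent t :
  (forall lam : T -> R,
     (forall l, lam l != 0 -> affine (c l) (d l) (facet_lift t) = 0) ->
     \sum_l lam l *: c l = 0 -> forall l, lam l = 0) ->
  forall lam : T -> R,
    (forall l, lam l != 0 -> affine (facet_normals l) (facet_offsets l) t = 0) ->
    \sum_l lam l *: facet_normals l = 0 -> forall l, lam l = 0.
Proof.
move=> indep lam lamt lam0.
have li : lam i = 0.
  apply/eqP/negPn/negP => /lamt.
  by rewrite affine_facets affine_facet_lift add0r eqxx => /eqP; rewrite oner_eq0.
pose E := \sum_l lam l *: c l.
pose mu l := if l == i then - (E 0 j / c i 0 j) else lam l.
have E0 : facet_normal E = 0 by rewrite -[RHS]lam0 facet_normal_sum.
have mu0 : forall l, mu l = 0.
  apply: indep => [l|].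
    rewrite /mu; have [->|li'] := eqVneq l i ; first by rewrite affine_facet_lift.
    by move=> /lamt; rewrite affine_facets (negPf li') addr0.
  rewrite (bigD1 i) //= {1}/mu eqxx scaleNr -(facet_normal_inj E0).
  rewrite /E (bigD1 i) //= li scale0r add0r addrC; apply/eqP; rewrite subr_eq0.
  by apply/eqP/eq_bigr => l /negPf li'; rewrite /mu li'.
move=> l; have [->//|li'] := eqVneq l i.
by have := mu0 l; rewrite /mu (negPf li').
Qed.

Definition cons_ffun (f : {ffun 'I_n -> T}) : {ffun 'I_n.+1 -> T} :=
  [ffun p => if unlift ord0 p is Some q then f q else i].

Lemma cons_ffun0 f : cons_ffun f ord0 = i.
Proof. by rewrite ffunE unlift_none. Qed.

Lemma cons_ffunS f q : cons_ffun f (lift ord0 q) = f q.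
Proof. by rewrite ffunE liftK. Qed.

(** Subtracting multiples of the row of [i] from the other rows clears the
    eliminated column, so the determinant loses exactly the pivot. *)
Lemma det_cons_ffun f :
  `|\det (normals c (cons_ffun f))| = `|c i 0 j| * `|\det (normals facet_normals f)|.
Proof.
(* The elementary row operations that clear the column [j] below the pivot. *)
pose L : 'M[R]_n.+1 := \matrix_(p, q)
  (if q == ord0 then (if p == ord0 then 1 else - (c (cons_ffun f p) 0 j / c i 0 j))
   else (p == q)%:R).
have Ltrig : is_trig_mx L.
  apply/is_trig_mxP => p q pq; rewrite mxE.
  have q0 : q != ord0 by apply: contraTneq pq => ->.
  by rewrite (negPf q0); case: eqP => // pqe; rewrite pqe ltnn in pq.
have detL : \det L = 1.
  rewrite det_trig // big1 // => p _; rewrite mxE eqxx.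
  by case: eqP.
pose E := L *m normals c (cons_ffun f).
have Erow p : row p E = if p == ord0 then c i else
    c (cons_ffun f p) - (c (cons_ffun f p) 0 j / c i 0 j) *: c i.
  rewrite /E row_mul mulmx_sum_row big_ord_recl rowK cons_ffun0.
  have LS q : row p L 0 (lift ord0 q) = (p == lift ord0 q)%:R by rewrite !mxE.
  under eq_bigr do rewrite LS rowK.
  rewrite !mxE /=; have [->|p0] := eqVneq p ord0.
    rewrite scale1r big1 ?addr0 // => q _.
    by rewrite -[ord0 == _]/false scale0r.
  have [q pq|p00] := unliftP ord0 p; last by rewrite p00 eqxx in p0.
  rewrite (bigD1 q) //= big1 => [|q' qq'].
    by rewrite pq eqxx scale1r scaleNr addr0 addrC.
  by rewrite pq (inj_eq lift_inj) eq_sym (negPf qq') scale0r.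
have detE : \det E = \det (normals c (cons_ffun f)).
  by rewrite /E det_mulmx detL mul1r.
rewrite -detE (expand_det_col E j) big_ord_recl big1 => [|q _].
  have -> : E ord0 j = c i 0 j by have /rowP/(_ j) := Erow ord0; rewrite mxE.
  rewrite addr0 normrM /cofactor normrM normrX normrN1 expr1n mul1r.
  congr (_ * `|\det _|); apply/matrixP => p k; rewrite 2![LHS]mxE.
  have /rowP/(_ (lift j k)) := Erow (lift ord0 p).
  by rewrite mxE => ->; rewrite /= cons_ffunS !mxE.
have /rowP/(_ j) := Erow (lift ord0 q); rewrite mxE => -> /=.
by rewrite !mxE divfK // subrr mul0r.
Qed.

Lemma unit_cons_ffun f :
  (normals c (cons_ffun f) \in unitmx) = (normals facet_normals f \in unitmx).
Proof.
by rewrite !unitmxE !unitfE -normr_gt0 det_cons_ffun pmulr_rgt0 ?normr_gt0.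
Qed.

Lemma vertex_cons_ffun f : normals facet_normals f \in unitmx ->
  vertex c d (cons_ffun f) = facet_lift (vertex facet_normals facet_offsets f).
Proof.
move=> fU; apply: vertex_unique => [|p]; first by rewrite unit_cons_ffun.
have [q|] := unliftP ord0 p => [->|->]; last first.
  by rewrite cons_ffun0 affine_facet_lift.
rewrite cons_ffunS; have := affine_vertex facet_offsets q fU.
rewrite affine_facets; case: eqP => [-> _|_]; last by rewrite addr0.
by rewrite affine_facet_lift.
Qed.

Lemma weights_cons_ffun f : normals facet_normals f \in unitmx ->
  forall q, weights c a (cons_ffun f) 0 (lift ord0 q)
          = weights facet_normals (facet_normal a) f 0 q.
Proof.
move=> fU q; have cU : normals c (cons_ffun f) \in unitmx by rewrite unit_cons_ffun.
rewrite (@weights_unique _ _ _ facet_normals (facet_normal a) f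
  (\row_q weights c a (cons_ffun f) 0 (lift ord0 q))) ?mxE //.
rewrite -[in RHS](weights_sum a cU) facet_normal_sum big_ord_recl cons_ffun0.
rewrite facet_normal_self scaler0 add0r; apply: eq_bigr => p _.
by rewrite mxE cons_ffunS.
Qed.

(** Passing to a facet through a vertex removes from its contribution the pivot
    from the determinant and the weight of the facet from the product, while
    the exponent [n + k] of the objective stays the same. *)
Lemma facet_vertex_volume k f : a 0 j != 0 ->
  (normals c (cons_ffun f) \in unitmx ->
   inside c d a b (vertex c d (cons_ffun f)) ->
   0 < affine a b (vertex c d (cons_ffun f)) ->
   forall p, weights c a (cons_ffun f) 0 p != 0) ->
  - Num.sg (c i 0 j) / a 0 j
    * vertex_volume facet_normals facet_offsets (facet_normal a) (facet_offset a b)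
        k.+1 f
  = vertex_volume c d a b k (cons_ffun f)
    * (weights c a (cons_ffun f) 0 ord0 * c i 0 j / a 0 j).
Proof.
move=> aj gen; rewrite /vertex_volume /cuts_vertex; case: ifP => [/and3P[fU xP gx]|]; last first.
  case fU: (_ \in unitmx); rewrite unit_cons_ffun fU /=; last by rewrite mulr0 mul0r.
  by rewrite vertex_cons_ffun // inside_facet affine_facet => ->; rewrite mulr0 mul0r.
have cU : normals c (cons_ffun f) \in unitmx by rewrite unit_cons_ffun.
rewrite inside_facet affine_facet -vertex_cons_ffun // in xP gx *.
rewrite cU xP gx /= det_cons_ffun big_ord_recl.
have w0 := gen cU xP gx ord0.
under [in RHS]eq_bigr do rewrite weights_cons_ffun //.
rewrite addnS addSn.
apply: cancel_pivot => //.
by move: fU; rewrite unitmxE unitfE normr_eq0.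
Qed.

End Facet.

(** * The divergence theorem for a simple polyhedron *)

Section Slicing.
Context {R : realType} {T : finType}.

Lemma measurable_inside n (c : T -> 'rV[R]_n) d a b :
  measurable [set x | inside c d a b x].
Proof.
have mh (e : 'rV[R]_n) h : measurable [set x | 0 <= affine e h x].
  rewrite (_ : mkset _ = affine e h @^-1` `[0, +oo[).
    by rewrite -[X in measurable X]setTI; exact: measurable_affine.
  by apply/seteqP; split=> x /=; rewrite in_itv /= andbT.
rewrite (_ : mkset _ = \bigcap_(i in [set: T]) [set x | 0 <= affine (c i) (d i) x]
    `&` [set x | 0 <= affine a b x]).
  by apply: measurableI => //; apply: fin_bigcap_measurable => //; exact: finite_finset.
apply/seteqP; split=> x /= => [/insideP[H ?]|[H ?]].
  by split=> // i _; exact: H.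
by apply/insideP; split=> // i; exact: H.
Qed.

Lemma divpow_ge0 k (y : R) : 0 <= y -> 0 <= divpow k y.
Proof. by move=> y0; rewrite divr_ge0 ?exprn_ge0. Qed.

Lemma measurable_divpow_affine n k (a : 'rV[R]_n) b (D : set (euclid R n)) :
  measurable_fun D (fun x => (divpow k (affine a b x))%:E).
Proof.
apply/measurable_EFinP; apply: measurable_funM; last exact: measurable_cst.
apply: measurable_funX; apply: measurable_funTS; exact: measurable_affine.
Qed.

Lemma integrable_divpow n (c : T -> 'rV[R]_n) d a b k (r : R) :
  (\int[lebesgue_point n]_(x in [set x | inside c d a b x])
     (divpow k (affine a b x))%:E = r%:E)%E ->
  (lebesgue_point n).-integrable [set x | inside c d a b x]
    (fun x => (divpow k (affine a b x))%:E).
Proof.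
move=> intE; apply/integrableP; split; first exact: measurable_divpow_affine.
rewrite (eq_integral (fun x => (divpow k (affine a b x))%:E)) ?intE ?ltry // => x.
rewrite inE /= => /insideP[_ gx].
by rewrite ger0_norm // divpow_ge0.
Qed.

Lemma ae_off_hyperplane n (e : 'rV[R]_n) h : e != 0 ->
  \forall x \ae lebesgue_point n, affine e h x <> 0.
Proof.
move=> e0; exists [set x | affine e h x = 0]; split; last by move=> x /= /contrapT.
  rewrite (_ : mkset _ = affine e h @^-1` [set 0]) //.
  by rewrite -[X in measurable X]setTI; exact: measurable_affine.
exact: hyperplane_null.
Qed.

Context {n : nat} (c : T -> 'rV[R]_n.+1) (d : T -> R) (a : 'rV[R]_n.+1) (b : R).
Context (M : R) (j : 'I_n.+1).

Hypothesis bounded : forall x, inside c d a b x -> forall k, `|tnth x k| <= M.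
Hypothesis simple : forall x, inside c d a b x -> 0 < affine a b x ->
  forall lam : T -> R, (forall i, lam i != 0 -> affine (c i) (d i) x = 0) ->
  \sum_i lam i *: c i = 0 -> forall i, lam i = 0.
Hypothesis aj : a 0 j != 0.

Let lift_ i t := facet_lift c d j i t.

(** Two facets that meet a line at the same point do so above a hyperplane:
    their normals are independent wherever they meet with a positive
    objective, so one facet does not contain the other. *)
Lemma ae_facets_distinct : \forall t \ae lebesgue_point n,
  forall i l, i != l -> c i 0 j != 0 -> c l 0 j != 0 ->
    facet_hit c d j i t = facet_hit c d j l t -> inside c d a b (lift_ i t) ->
    affine a b (lift_ i t) = 0.
Proof.
apply: filter_forall => i; apply: filter_forall => l.
have [->|il] := eqVneq i l; first by apply: nearW.
have [ci|ci] := eqVneq (c i 0 j) 0; first by apply: nearW.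
have [nobad|/existsNP[t0 bad]] := pselect (forall t,
    facet_hit c d j i t = facet_hit c d j l t -> inside c d a b (lift_ i t) ->
    affine a b (lift_ i t) = 0).
  by apply: nearW => t _ _ _; exact: nobad.
have tightl t : c l 0 j != 0 -> facet_hit c d j i t = facet_hit c d j l t ->
    affine (c l) (d l) (lift_ i t) = 0.
  by move=> cl hil; rewrite /lift_ /facet_lift hil affine_facet_lift.
have [cl|cl] := eqVneq (c l 0 j) 0; first by apply: nearW.
have nl : facet_normals c j i l != 0.
  apply/eqP => /(facet_normal_inj ci) clE; apply: bad => hil xP.
  have : 0 <= affine a b (lift_ i t0) by case/insideP: xP.
  rewrite le_eqVlt => /predU1P[//|gx].
    (* If the hyperplanes coincided, the normal of [l] would be [r] times that of
     [i], although both constraints are tight at the lift of [t0]. *)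
pose r := c l 0 j / c i 0 j.
  pose lam k := if k == l then 1 else if k == i then - r else 0 : R.
  have : lam l = 0.
    apply: (simple xP gx) => [k|].
      rewrite /lam; have [->|kl] := eqVneq k l; first by rewrite tightl.
      have [->|ki] := eqVneq k i; first by rewrite affine_facet_lift.
      by rewrite eqxx.
    rewrite (bigD1 l) //= (bigD1 i) //= big1 => [|k /andP[/negPf kl /negPf ki]].
      by rewrite /lam eqxx (negPf il) eqxx scale1r addr0 {1}clE scaleNr subrr.
    by rewrite /lam kl ki scale0r.
  by rewrite /lam eqxx => /eqP; rewrite oner_eq0.
apply: filterS (ae_off_hyperplane (facet_offsets c d j i l) nl) => t off _ _ _ hil _.
case: off; rewrite affine_facets // tightl // add0r eq_sym (negPf il) //.
Qed.

Lemma integral_slice t k :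
  (forall i l, i != l -> c i 0 j != 0 -> c l 0 j != 0 ->
    facet_hit c d j i t = facet_hit c d j l t -> inside c d a b (lift_ i t) ->
    affine a b (lift_ i t) = 0) ->
  (\int[lebesgue_measure]_(s in [set s | inside c d a b (insert_coord j s t)])
     (divpow k (affine a b (insert_coord j s t)))%:E
   = (\sum_(i | (c i 0 j != 0) && inside c d a b (lift_ i t))
        - Num.sg (c i 0 j) / a 0 j * divpow k.+1 (affine a b (lift_ i t)))%:E)%E.
Proof.
move=> sep; pose al i := affine (col' j (c i)) (d i) t.
pose be := affine (col' j a) b t.
have affE (e : 'rV[R]_n.+1) h s : affine e h (insert_coord j s t)
    = e 0 j * s + affine (col' j e) h t.
  by rewrite affine_insert /affine; ring.
have inE_ s : inside c d a b (insert_coord j s t)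
    = [forall i, 0 <= c i 0 j * s + al i] && (0 <= a 0 j * s + be).
  by rewrite /inside affE; congr andb; apply: eq_forallb => i; rewrite affE.
have := @integral_line _ T (fun i => c i 0 j) al (a 0 j) be M k aj.
under eq_fun do rewrite -inE_. move=> IL.
rewrite (eq_integral (fun s : measurableTypeR R => (divpow k (a 0 j * s + be))%:E)) => [|s _]; last first.
  by rewrite affE.
rewrite IL.
- congr (_%:E); apply: eq_big => [i|i _]; first by rewrite -inE_.
  by rewrite -affE.
- by move=> s; rewrite -inE_ => /bounded/(_ j); rewrite tnth_insert_same.
- by move=> i l il ci cl hil; rewrite -inE_ -affE => xP; exact: sep hil xP.
Qed.

(** The divergence theorem for the field [divpow k.+1 g / a_j] in direction
    [j]: its divergence is [divpow k g], it vanishes on the face [g = 0], it is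
    tangent to the faces with [c i 0 j = 0], and the other faces are graphs over
    the hyperplane [x_j = 0]. *)
Lemma integral_facets k (r : T -> R) :
  (forall i, c i 0 j != 0 ->
    (\int[lebesgue_point n]_(t in [set t | inside (facet_normals c j i)
         (facet_offsets c d j i) (facet_normal c j i a) (facet_offset c d j i a b) t])
       (divpow k.+1 (affine (facet_normal c j i a) (facet_offset c d j i a b) t))%:E
     = (r i)%:E)%E) ->
  (\int[lebesgue_point n.+1]_(x in [set x | inside c d a b x])
     (divpow k (affine a b x))%:E
   = (\sum_(i | c i 0 j != 0) - Num.sg (c i 0 j) / a 0 j * r i)%:E)%E.
Proof.
move=> rE.
pose D := [set x | inside c d a b x].
pose D' i := [set t | inside (facet_normals c j i)
         (facet_offsets c d j i) (facet_normal c j i a) (facet_offset c d j i a b) t].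
pose phi := (fun x => (divpow k (affine a b x))%:E) \_ D.
pose psi i := (fun t => (divpow k.+1 (affine (facet_normal c j i a)
                   (facet_offset c d j i a b) t))%:E) \_ (D' i).
have mD : measurable D by exact: measurable_inside.
have mD' i : measurable (D' i) by exact: measurable_inside.
have mphi : measurable_fun setT phi.
  by apply/(measurable_restrict _ mD measurableT); exact: measurable_divpow_affine.
have phi0 x : (0 <= phi x)%E.
  rewrite /phi patchE; case: ifP => //; rewrite inE => /insideP[_ gx].
  by rewrite lee_fin divpow_ge0.
have ipsi i : c i 0 j != 0 -> (lebesgue_point n).-integrable setT (psi i).
  move=> ci; apply/(integrable_mkcond _ (mD' i)).
  exact: integrable_divpow (rE i ci).
rewrite integral_mkcond -/phi (integral_insert_coord j) //.
pose coef i : R := - Num.sg (c i 0 j) / a 0 j.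
pose h i t := (if c i 0%R j == 0%R then 0 else (coef i)%:E * psi i t)%E.
have ih i : (lebesgue_point n).-integrable setT (h i).
  rewrite /h; have [_|ci] := eqVneq (c i 0 j) 0; first exact: integrable0.
  by apply: integrableZl => //; exact: ipsi.
transitivity (\int[lebesgue_point n]_t (\sum_i h i t))%E.
  apply: ae_eq_integral => //.
  - apply: (measurable_fun_fubini_tonelli_G (m1 := lebesgue_measure)
      (fun p : measurableTypeR R * euclid R n => phi (insert_coord j p.1 p.2))) => //.
    by apply: measurableT_comp => //; exact: measurable_insert_coord.
  - by apply: emeasurable_sum => i; case/integrableP: (ih i).
  - apply: filterS ae_facets_distinct => t sep _.
    transitivity (\int[lebesgue_measure]_(s in [set s | inside c d a b (insert_coord j s t)])
        (divpow k (affine a b (insert_coord j s t)))%:E)%E.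
      rewrite [RHS]integral_mkcond; apply: eq_integral => s _.
      rewrite /phi !patchE; congr (if _ then _ else _).
    rewrite (integral_slice _ sep) -sumEFin big_mkcond; apply: eq_bigr => i _.
    rewrite /h; have [//|ci] := eqVneq (c i 0 j) 0.
    rewrite /psi patchE -inside_facet //= affine_facet //.
    case: ifP => tP; first by rewrite mem_set //.
    by rewrite memNset ?mule0 // /D' /= tP.
rewrite integral_sum // -sumEFin [RHS]big_mkcond; apply: eq_bigr => i _.
rewrite /h; have [_|ci] := eqVneq (c i 0 j) 0; first exact: integral0.
by rewrite integralZl //= -?integral_mkcond ?rE //; exact: ipsi.
Qed.

End Slicing.

(** * The vertex formula for a simple polyhedron *)

Section PolyhedronIntegral.
Context {R : realType} {T : finType}.

Lemma sum_cons_ffun n (V : nmodType) (F : {ffun 'I_n.+1 -> T} -> V) :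
  \sum_f F f = \sum_i \sum_(f : {ffun 'I_n -> T}) F (cons_ffun i f).
Proof.
pose tl (f : {ffun 'I_n.+1 -> T}) : {ffun 'I_n -> T} := [ffun q => f (lift ord0 q)].
rewrite pair_big /= (reindex (fun p : T * {ffun 'I_n -> T} => cons_ffun p.1 p.2)) //=.
exists (fun f : {ffun 'I_n.+1 -> T} => (f ord0, tl f)) => [[i f] _|f _] /=.
  by rewrite cons_ffun0; congr pair; apply/ffunP => q; rewrite ffunE cons_ffunS.
apply/ffunP => p; have [q|] := unliftP ord0 p => ->; last by rewrite cons_ffun0.
by rewrite cons_ffunS ffunE.
Qed.

(** Each of the [n.+1] facets at a vertex takes its turn at being listed first:
    by symmetry their terms can be averaged, and they add up to the
    decomposition of the slope of the objective in the coordinate [j]. *)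
Lemma sum_weights_symmetric n (c : T -> 'rV[R]_n.+1) d a b k (j : 'I_n.+1) :
  n.+1%:R * (\sum_(f : {ffun 'I_n.+1 -> T}) vertex_volume c d a b k f
     * (weights c a f 0 ord0 * c (f ord0) 0 j))
  = (\sum_(f : {ffun 'I_n.+1 -> T}) vertex_volume c d a b k f) * a 0 j.
Proof.
pose S p := \sum_(f : {ffun 'I_n.+1 -> T}) vertex_volume c d a b k f
     * (weights c a f 0 p * c (f p) 0 j).
have SE p : S ord0 = S p.
  pose sw (f : {ffun 'I_n.+1 -> T}) : {ffun 'I_n.+1 -> T} :=
    [ffun q => f (tperm ord0 p q)].
  have swK : involutive sw by move=> f; apply/ffunP => q; rewrite !ffunE tpermK.
  rewrite /S [RHS](reindex_inj (inv_inj swK)); apply: eq_bigr => f _.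
  have [-> wE] := vertex_volume_perm c d a b k f (tperm ord0 p).
  have [fU|fU] := boolP (normals c f \in unitmx).
    by rewrite wE // ffunE tpermR.
  by rewrite /vertex_volume /cuts_vertex (negPf fU) !mul0r.
rewrite -/(S ord0) mulr_natl -[in LHS](card_ord n.+1) -sumr_const.
rewrite (eq_bigr S) => [|p _]; last exact: SE.
rewrite /S exchange_big mulr_suml; apply: eq_bigr => f _ /=.
rewrite -mulr_sumr; have [fU|fU] := boolP (normals c f \in unitmx).
  congr (_ * _); rewrite -[in RHS](weights_sum a fU) summxE.
  by apply: eq_big => // p _; rewrite [RHS]mxE.
by rewrite /vertex_volume /cuts_vertex (negPf fU) !mul0r.
Qed.

(** Slicing trades one dimension for one more power of the objective, so the
    induction on [n] is for all [k] at once.  The objective may become constant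
    on a facet; there the exponent is positive, and a constant objective that is
    positive somewhere would have zero weights at a vertex.  For a constant
    objective and [k = 0] the formula fails, whence the first hypothesis. *)
Theorem integral_polyhedron n (c : T -> 'rV[R]_n) (d : T -> R) (a : 'rV[R]_n)
    (b M : R) (k : nat) :
  (a != 0) || (0 < k)%N ->
  (forall x, inside c d a b x -> forall j, `|tnth x j| <= M) ->
  (forall x, inside c d a b x -> 0 < affine a b x ->
     forall lam : T -> R, (forall i, lam i != 0 -> affine (c i) (d i) x = 0) ->
     \sum_i lam i *: c i = 0 -> forall i, lam i = 0) ->
  (forall f, normals c f \in unitmx -> inside c d a b (vertex c d f) ->
     0 < affine a b (vertex c d f) -> forall p, weights c a f 0 p != 0) ->
  (\int[lebesgue_point n]_(x in [set x | inside c d a b x])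
     (divpow k (affine a b x))%:E
   = ((\sum_(f : {ffun 'I_n -> T}) vertex_volume c d a b k f) / n`!%:R)%:E)%E.
Proof.
elim: n c d a b k => [|n IHn] c d a b k ak bnd simple gen.
  have k0 : (0 < k)%N by move: ak; rewrite [a]thinmx0 eqxx.
  rewrite [LHS]integral_dirac; [|exact: measurable_inside|exact: measurable_divpow_affine].
  pose f0 : {ffun 'I_0 -> T} := ffun0 (card_ord 0).
  have f0U : normals c f0 \in unitmx by rewrite unitmxE det_mx00 unitr1.
  rewrite (bigD1 f0) //= big1 => [|f /eqP[]]; last by apply/ffunP => -[].
  rewrite addr0 fact0 divr1 /vertex_volume /cuts_vertex f0U det_mx00 big_ord0 normr1 mul1r invr1 mulr1.
  rewrite add0n /= (tuple0 (vertex c d f0)).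
  rewrite diracE; case: ifP => [/andP[xP _]|/negbT].
    by rewrite mem_set // mul1e.
  rewrite negb_and => /orP[xP|gx].
    by rewrite memNset ?mul0e //; exact/negP.
  have [xP|xP] := boolP (inside c d a b [tuple]); last by rewrite memNset ?mul0e //; exact/negP.
  have -> : affine a b [tuple] = 0.
    by apply/le_anti; rewrite leNgt gx; case/insideP: xP.
  by rewrite /divpow expr0n (gtn_eqF k0) mul0r mule0.
have [a0|/rV0Pn[j aj]] := eqVneq a 0.
  have k0 : (0 < k)%N by move: ak; rewrite a0 eqxx.
  have g0 x : inside c d a b x -> affine a b x = 0.
    move=> xP; apply/eqP; rewrite eq_le; case/insideP: (xP) => _ ->; rewrite andbT.
    rewrite leNgt; apply/negP => gx.
    have [v [vP gv _ /spanning_basis[f fv fU]]] := exists_vertex bnd xP gx.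
    have vE : vertex c d f = v.
      by apply: vertex_unique => // p; have := fv p; rewrite inE => /eqP.
    have := gen f fU; rewrite vE => /(_ vP gv ord0).
    by rewrite /weights a0 mul0mx mxE eqxx.
  rewrite big1 => [|f _]; last first.
    by rewrite /vertex_volume /cuts_vertex; case: ifP => // /and3P[_ /g0 ->]; rewrite ltxx.
  rewrite mul0r (eq_integral (fun=> 0%E)) ?integral0 // => x.
  rewrite inE /= => /g0 ->; congr (_%:E).
  by rewrite /divpow expr0n (gtn_eqF k0) mul0r.
pose V i := \sum_(f : {ffun 'I_n -> T}) vertex_volume (facet_normals c j i)
  (facet_offsets c d j i) (facet_normal c j i a) (facet_offset c d j i a b) k.+1 f.
rewrite (integral_facets bnd simple aj (r := fun i => V i / n`!%:R)); last first.
  move=> i ci; apply: IHn.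
  - by rewrite orbT.
  - by move=> t; rewrite inside_facet // => /bnd tM l; rewrite -(tnth_facet_lift c d j i).
  - move=> t; rewrite inside_facet // affine_facet // => tP gt.
    apply: facet_independent => //; exact: simple.
  - move=> f fU; rewrite inside_facet // affine_facet // -vertex_cons_ffun // => vP gv p.
    rewrite -weights_cons_ffun //; apply: gen => //.
    by rewrite (unit_cons_ffun ci).
congr (_%:E).
pose W := \sum_(f : {ffun 'I_n.+1 -> T}) vertex_volume c d a b k f
     * (weights c a f 0 ord0 * c (f ord0) 0 j).
(* A facet parallel to the coordinate [j] has [c i 0 j = 0], so the sum over all
   ordered systems of constraints may include it. *)
transitivity (W / a 0 j / n`!%:R).
  rewrite /W sum_cons_ffun !mulr_suml big_mkcond; apply: eq_bigr => i _.
  have [ci|ci] := eqVneq (c i 0 j) 0.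
    rewrite big1 ?mul0r // => f _.
    by rewrite cons_ffun0 ci !mulr0.
  rewrite mulrA /V mulr_sumr !mulr_suml; apply: eq_bigr => f _; congr (_ / _).
  rewrite facet_vertex_volume ?cons_ffun0 ?mulrA // => fU vP gv p; exact: gen.
have WE := sum_weights_symmetric c d a b k j; rewrite -/W in WE.
set S := \sum_f _ in WE *.
have -> : S = n.+1%:R * W / a 0 j by rewrite WE mulfK.
have n0 : n`!%:R != 0 :> R by rewrite pnatr_eq0 -lt0n fact_gt0.
have n1 : n.+1%:R != 0 :> R by rewrite pnatr_eq0.
by rewrite factS natrM; field; rewrite n0 nat1r n1.
Qed.

End PolyhedronIntegral.

(** * From ordered systems of constraints to vertices *)

Section GroupByVertex.
Context {R : realType} {T : finType} {n : nat}.
Context (c : T -> 'rV[R]_n) (d : T -> R) (a : 'rV[R]_n) (b : R).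
Implicit Types (f : {ffun 'I_n -> T}) (x v : euclid R n).

Definition vertices : seq (euclid R n) :=
  undup [seq vertex c d f | f <- enum [pred f | cuts_vertex c d a b f]].

Lemma mem_vertices v :
  reflect (exists2 f, cuts_vertex c d a b f & v = vertex c d f) (v \in vertices).
Proof.
rewrite mem_undup; apply: (iffP mapP) => -[f].
  by rewrite mem_enum inE => ? ->; exists f.
by move=> ? ->; exists f => //; rewrite mem_enum inE.
Qed.

Lemma active_codom f v : normals c f \in unitmx -> vertex c d f = v ->
  (#|active c d v| <= n)%N -> active c d v = [set f p | p in 'I_n]%SET.
Proof.
move=> fU <- card; apply/esym/eqP.
rewrite eqEcard card_imset ?card_ord ?card ?andbT; last exact: normals_inj fU.
by apply/fintype.subsetP => _ /imsetP[p _ ->]; rewrite inE affine_vertex.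
Qed.

(** Any ordering of the [n] tight constraints at a vertex cuts out that vertex. *)
Lemma card_vertex_orderings f0 : normals c f0 \in unitmx ->
  (#|active c d (vertex c d f0)| <= n)%N ->
  #|[set f | (normals c f \in unitmx) && (vertex c d f == vertex c d f0)]%SET| = n`!.
Proof.
move=> f0U card; set v := vertex c d f0 in card *.
have act0 := active_codom f0U erefl card.
have cardE : #|active c d v| = n.
  by rewrite act0 card_imset ?card_ord //; exact: normals_inj f0U.
rewrite -[RHS](ffactnn n) -[X in (X ^_ _)%N]cardE -[X in (_ ^_ X)%N](card_ord n).
rewrite -card_inj_ffuns_on; apply: eq_card => f; rewrite !inE.
apply/andP/andP => [[fU /eqP fv]|[/ffun_onP fact /injectiveP finj]].
  split; last by apply/injectiveP; exact: normals_inj fU.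
  by apply/ffun_onP => p; rewrite (active_codom fU fv card) imset_f.
have fim : [set f p | p in 'I_n]%SET = active c d v.
  apply/eqP; rewrite eqEcard card_imset // card_ord cardE leqnn andbT.
  by apply/fintype.subsetP => _ /imsetP[p _ ->].
have fU : normals c f \in unitmx.
  rewrite -row_full_unit; move: f0U; rewrite -row_full_unit /row_full.
  move=> /eqP rk0; rewrite eqn_leq rank_leq_row -{1}rk0 mxrankS //.
  apply/row_subP => p; rewrite rowK.
  have : f0 p \in active c d v by rewrite act0 imset_f.
  rewrite -fim => /imsetP[q _ ->].
  by rewrite -(rowK (fun q => c (f q))) row_sub.
split=> //; apply/eqP/vertex_unique => // p.
by have := fact p; rewrite inE => /eqP.
Qed.

(** The sum over all ordered systems of constraints meets each vertex once for
    every ordering of the constraints tight there. *)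
Lemma sum_vertex_volume k (F : euclid R n -> R) :
  (forall x, inside c d a b x -> 0 < affine a b x -> (#|active c d x| <= n)%N) ->
  (forall f, cuts_vertex c d a b f -> vertex_volume c d a b k f = F (vertex c d f)) ->
  \sum_f vertex_volume c d a b k f = n`!%:R * \sum_(v <- vertices) F v.
Proof.
move=> card FE; rewrite (bigID (cuts_vertex c d a b)) /= [X in _ + X]big1 ?addr0; last first.
  by move=> f /negPf fN; rewrite /vertex_volume fN.
rewrite (eq_bigr (fun f => \sum_(v <- vertices | v == vertex c d f) F v)); last first.
  move=> f fc; rewrite FE // -big_filter filter_pred1_uniq ?big_seq1 ?undup_uniq //.
  by apply/mem_vertices; exists f.
rewrite (exchange_big_dep predT) //= mulr_sumr; apply: eq_big_seq => v.
move=> /mem_vertices[f0 /and3P[f0U xP gx] ->].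
rewrite sumr_const [RHS]mulr_natl; congr (_ *+ _).
rewrite -(card_vertex_orderings f0U (card _ xP gx)); apply: eq_card => f.
rewrite [RHS]inE unfold_in /=.
have [fv|fv] := eqVneq (vertex c d f) (vertex c d f0).
  by rewrite andbT /cuts_vertex fv xP gx !andbT.
by rewrite !andbF.
Qed.

End GroupByVertex.

(** * Minors and Cramer's rule *)

Section Minors.
Context {R : realType} {n m : nat} (A : 'M[R]_(n, m)).
Implicit Types (J : seq 'I_n) (K : seq 'I_m) (W : 'I_m -> R).

(** The entries with default values, over an index type of the size [s]: this
    frees the determinant from the dependency on the list of rows. *)
Lemma minor_nth (j0 : 'I_n) (k0 : 'I_m) s J K : size J = s -> size K = s ->
  minor A J K = \det (\matrix_(p < s, q < s) A (nth j0 J p) (nth k0 K q)).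
Proof.
move=> <- szK; congr (\det _); apply/matrixP => p q; rewrite !mxE.
by rewrite (nth_map k0) ?szK // (tnth_nth j0).
Qed.

Lemma minor_dependent J K W : size J = size K -> uniq K ->
  has (fun k => W k != 0) K ->
  (forall j, j \in J -> \sum_(k <- K) W k * A j k = 0) -> minor A J K = 0.
Proof.
move=> szJ uK /hasP[k0 k0K Wk0] dep.
case: J => [|j0 J] in szJ dep *; first by case: K k0K szJ {uK dep}.
rewrite (minor_nth j0 k0 (esym erefl) (esym szJ)) -det_tr; apply/eqP/det0P.
exists (\row_q W (nth k0 K q)).
  have ltk : (index k0 K < size (j0 :: J))%N by rewrite szJ index_mem.
  apply/rV0Pn; exists (Ordinal ltk).
  by rewrite mxE /= nth_index.
apply/rowP => p; rewrite !mxE; have := dep (nth j0 (j0 :: J) p) (mem_nth _ (ltn_ord p)).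
rewrite (big_nth k0) -szJ big_mkord => E; rewrite -[RHS]E.
by apply: eq_bigr => q _; rewrite !mxE.
Qed.

Lemma nth_rem (T : eqType) (x0 x : T) (s : seq T) q : x \in s ->
  nth x0 (rem x s) q = nth x0 s (bump (index x s) q).
Proof.
rewrite -index_mem => xs; rewrite remE nth_cat size_take xs /bump.
case: ltnP => [qx|qx]; first by rewrite add0n nth_take.
by rewrite nth_drop add1n addSn subnKC.
Qed.

Lemma bump_ord s (q : 'I_s) : bump s q = q.
Proof. by rewrite /bump leqNgt ltn_ord. Qed.

(** Cramer's rule with the replaced column moved to the end of the list. *)
Lemma minor_replace J K W (l t : 'I_m) : size J = size K -> uniq K -> t \in K ->
  (forall j, j \in J -> A j l = \sum_(k <- K) W k * A j k) ->
  minor A J (rcons (rem t K) l)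
  = (-1) ^+ (index t K + (size K).-1) * W t * minor A J K.
Proof.
move=> szJ uK tK colE.
case: J => [|j0 J] in szJ colE *; first by case: K tK szJ {uK colE}.
set J1 := j0 :: J in szJ colE *; have szJ1 : size J1 = (size J).+1 by [].
rewrite -szJ szJ1 succnK; move: (size J) szJ1 => s szJ1.
have szK : size K = s.+1 by rewrite -szJ.
have ltK : (index t K < s.+1)%N by rewrite -szK index_mem.
pose pos := Ordinal ltK.
have szR : size (rcons (rem t K) l) = s.+1 by rewrite size_rcons size_rem // szK.
rewrite (minor_nth j0 l szJ1 szR) (minor_nth j0 l szJ1 szK).
set N := (X in _ = _ * \det X).
(* [Q] expresses the new columns in the old ones: it drops the column of [t] and
   appends the combination [W]. *)
pose Q : 'M[R]_s.+1 := \matrix_(r, q)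
  if unlift ord_max q is Some q' then (r == lift pos q')%:R else W (nth l K r).
have -> : \matrix_(p, q) A (nth j0 J1 p) (nth l (rcons (rem t K) l) q) = N *m Q.
  apply/matrixP => p q; rewrite !mxE.
  have [q'|] := unliftP ord_max q => ->.
    rewrite (bigD1 (lift pos q')) //= big1 => [|r rq].
      rewrite !mxE liftK eqxx mulr1 addr0; congr (A _ _).
      by rewrite bump_ord nth_rcons size_rem // szK ltn_ord nth_rem.
    by rewrite !mxE liftK (negPf rq) mulr0.
  rewrite /= nth_rcons size_rem // szK /= ltnn eqxx colE; last by rewrite mem_nth // szJ1.
  rewrite (big_nth l) szK big_mkord; apply: eq_bigr => r _.
  by rewrite !mxE unlift_none mulrC.
rewrite det_mulmx mulrC; congr (_ * _).
rewrite (expand_det_row _ pos) (bigD1 ord_max) //= big1 => [|q qmax]; last first.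
  have [q'|qE] := unliftP ord_max q; last by rewrite qE eqxx in qmax.
  by move=> ->; rewrite mxE liftK (negPf (neq_lift _ _)) mul0r.
rewrite addr0 mxE unlift_none nth_index // /cofactor.
rewrite (_ : row' _ _ = 1%:M); first by rewrite det1 mulr1 mulrC.
apply/matrixP => p q; rewrite !mxE liftK (inj_eq lift_inj).
by [].
Qed.

(** Clearing the first column by the relation [W] leaves only the entry of the
    row [t], so up to sign the minor is that residual times the minor of the rest. *)
Lemma minor_border J K W (l : 'I_m) (t : 'I_n) : size J = size K ->
  (forall j, j \in J -> A j l = \sum_(k <- K) W k * A j k) ->
  minor A (rcons J t) (l :: K)
  = (-1) ^+ size J * (A t l - \sum_(k <- K) W k * A t k) * minor A J K.
Proof.
move=> szJ colE; set rho := A t l - _.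
have [s sJ] : {s | size J = s} by exists (size J).
have sK : size K = s by rewrite -szJ.
have sJt : size (rcons J t) = s.+1 by rewrite size_rcons sJ.
have slK : size (l :: K) = s.+1 by rewrite /= sK.
rewrite (minor_nth t l sJt slK) (minor_nth t l sJ sK) sJ.
set N := (X in _ = _ * \det X).
have sumE j : \sum_(r < s) W (nth l K r) * A j (nth l K r) = \sum_(k <- K) W k * A j k.
  by rewrite (big_nth l) big_mkord sK.
pose entry (p q : 'I_s.+1) := A (nth t (rcons J t) p) (nth l (l :: K) q).
pose N0 : 'M[R]_s.+1 := \matrix_(p, q)
  if q == ord0 then (p == ord_max)%:R * rho else entry p q.
(* [Q] adds to the first column the combination [W] of the others. *)
pose Q : 'M[R]_s.+1 := \matrix_(r, q)
  if unlift ord0 r is Some r' then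
    if q == ord0 then W (nth l K r') else (r == q)%:R
  else (q == ord0)%:R.
have -> : \matrix_(p, q) A (nth t (rcons J t) p) (nth l (l :: K) q) = N0 *m Q.
  apply/matrixP => p q; rewrite !mxE -/(entry p q).
  rewrite big_ord_recl !mxE unlift_none eqxx.
  under eq_bigr => r _ do rewrite !mxE liftK [_ == ord0]/= -/(entry _ _).
  have [q'|] := unliftP ord0 q => ->; last first.
    rewrite eqxx mulr1 (eq_bigr (fun r : 'I_s =>
      W (nth l K r) * A (nth t (rcons J t) p) (nth l K r))); last first.
      by move=> r _; rewrite mulrC.
    rewrite sumE /entry /=.
    have [p'|] := unliftP ord_max p => ->.
      rewrite eq_sym (negPf (neq_lift _ _)) mul0r add0r lift_max nth_rcons sJ ltn_ord.
      by rewrite colE // mem_nth // sJ.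
    by rewrite eqxx mul1r nth_rcons sJ ltnn eqxx /rho subrK.
  rewrite [_ == ord0]/= mulr0 add0r (bigD1 q') //= big1 => [|r rq].
    by rewrite eqxx mulr1 addr0.
  by rewrite (inj_eq lift_inj) (negPf rq) mulr0.
rewrite det_mulmx (det_trig (A := Q)); last first.
  apply/is_trig_mxP => r q rq; rewrite mxE.
  have q0 : q != ord0 by apply: contraTneq rq => ->.
  have [r'|] := unliftP ord0 r => rE; rewrite (negPf q0) //.
  by case: eqP rq => // ->; rewrite ltnn.
rewrite [X in _ * X]big1 ?mulr1 => [|r _]; last first.
  rewrite mxE; have [r'|] := unliftP ord0 r => ->; last by rewrite eqxx.
  by rewrite [_ == ord0]/= eqxx.
rewrite (expand_det_col _ ord0) (bigD1 ord_max) //= big1 => [|p pmax]; last first.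
  by rewrite mxE eqxx (negPf pmax) mul0r mul0r.
rewrite mxE !eqxx mul1r addr0 /cofactor addn0 /= mulrCA mulrA; congr (_ * _ * \det _).
apply/matrixP => p q; rewrite !mxE /= /entry lift_max nth_rcons sJ ltn_ord.
by [].
Qed.

End Minors.

(** * Determinants with unit rows *)

Lemma injective_same_image n (T : finType) (f f0 : {ffun 'I_n -> T}) :
  injective f -> (forall p, exists q, f p = f0 q) ->
  exists s : 'S_n, f = [ffun p => f0 (s p)].
Proof.
move=> finj ff0; have im p : f p \in codom f0.
  by have [q ->] := ff0 p; exact: codom_f.
have sinj : injective (fun p => iinv (im p)).
  by move=> p q pq; apply: finj; rewrite -(f_iinv (im p)) -(f_iinv (im q)) pq.
by exists (perm sinj); apply/ffunP => p; rewrite ffunE permE f_iinv.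
Qed.

Section DetUnitRows.
Context {R : realType}.

Lemma det_mxsub_inj n n' (M : 'M[R]_n) (h : 'I_n' -> 'I_n) :
  n' = n -> injective h -> \det (mxsub h h M) = \det M.
Proof.
move=> en; subst n' => hinj.
have -> : mxsub h h M = row_perm (perm hinj) (col_perm (perm hinj) M).
  by apply/matrixP => p q; rewrite !mxE !permE.
by rewrite row_permE col_permE !det_mulmx !det_perm odd_permV mulrCA -signr_addb addbb mulr1.
Qed.

(** Listing the indices in [S] first makes the matrix block triangular, with a
    diagonal block of entries of norm [1] for the indices outside [S]. *)
Lemma norm_det_unit_rows n (M : 'M[R]_n) (S : {set 'I_n}) (e : 'I_n -> R) :
  (forall j, `|e j| = 1) ->
  (forall j k, j \notin S -> M j k = e j * (j == k)%:R) ->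
  `|\det M|
  = `|\det (\matrix_(p < #|S|, q < #|S|) M (enum_val p) (enum_val q))|.
Proof.
move=> e1 Me.
pose h (u : 'I_(#|S| + #|~: S|)) : 'I_n :=
  match fintype.split u with inl p => enum_val p | inr q => enum_val q end.
have hl p : h (lshift _ p) = enum_val p by rewrite /h (unsplitK (inl p)).
have hr q : h (rshift _ q) = enum_val q by rewrite /h (unsplitK (inr q)).
have NS (q : 'I_#|~: S|) : enum_val q \notin S by have := enum_valP q; rewrite inE.
have hinj : injective h.
  move=> u w; rewrite -(splitK u) -(splitK w).
  case: (fintype.split u) (fintype.split w) => [p|p] [q|q]; rewrite /= ?hl ?hr.
  - by move/enum_val_inj ->.
  - by move=> E; have := NS q; rewrite -E enum_valP.
  - by move=> E; have := NS p; rewrite E enum_valP.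
  - by move/enum_val_inj ->.
have en : (#|S| + #|~: S|)%N = n by rewrite cardsC card_ord.
rewrite -(det_mxsub_inj M en hinj) -[mxsub h h M]submxK.
rewrite (_ : dlsubmx _ = 0); last first.
  apply/matrixP => p q; rewrite !mxE hl hr Me // (_ : (_ == _) = false) ?mulr0 //.
  by apply/negP => /eqP E; have := NS p; rewrite E enum_valP.
rewrite det_ublock normrM.
rewrite (_ : drsubmx _ = diag_mx (\row_q e (enum_val q))).
  rewrite det_diag [X in _ * X]normr_prod [X in _ * X]big1 ?mulr1 => [|q _]; last by rewrite mxE.
  by congr (`|\det _|); apply/matrixP => p q; rewrite !mxE !hl.
apply/matrixP => p q; rewrite !mxE !hr Me // (inj_eq enum_val_inj) mulr_natr.
by [].
Qed.

End DetUnitRows.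

(** * The clipped cube as a simple polyhedron *)

Section ClippedCube.
Context {R : realType} {n m : nat} (A : 'M[R]_(n, m.+1)) (r : 'I_m.+1 -> R).
Implicit Types (x v : euclid R n) (i : 'I_m.+1) (t : 'I_n).

(** The constraint [inr (t, false)] is [x_t >= 0] and [inr (t, true)] is
    [1 - x_t >= 0].  The last of the half-spaces is cut by the objective, so its
    index stands for the trivial constraint [1 >= 0]. *)
Definition clip_normal (tau : 'I_m.+1 + 'I_n * bool) : 'rV[R]_n :=
  match tau with
  | inl i => if i == ord_max then 0 else \row_j A j i
  | inr p => (-1) ^+ p.2 *: delta_mx 0 p.1
  end.

Definition clip_offset (tau : 'I_m.+1 + 'I_n * bool) : R :=
  match tau with
  | inl i => if i == ord_max then 1 else r i
  | inr p => p.2%:R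
  end.

Let goal_normal : 'rV[R]_n := \row_j A j ord_max.
Let goal_offset : R := r ord_max.

Lemma affine_row i x : affine (\row_j A j i) (r i) x = Defs.g A r i x.
Proof. by rewrite /affine /Defs.g; congr (_ + _); apply: eq_bigr => j _; rewrite mxE. Qed.

Lemma affine_facet_cube p x :
  affine (clip_normal (inr p)) (clip_offset (inr p)) x
  = if p.2 then 1 - tnth x p.1 else tnth x p.1.
Proof.
suff -> : affine (clip_normal (inr p)) (clip_offset (inr p)) x
    = (-1) ^+ p.2 * tnth x p.1 + p.2%:R.
  by case: p.2; rewrite /= ?expr1 ?mulN1r ?expr0 ?mul1r ?addr0 // addrC.
rewrite /affine (bigD1 p.1) //= big1 => [|j jp].
  by rewrite !mxE !eqxx mulr1 addr0.
by rewrite !mxE (negPf jp) andbF mulr0 mul0r.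
Qed.

Definition tight x : {set 'I_m.+1} :=
  [set i | (i != ord_max) && (Defs.g A r i x == 0)]%SET.

Definition cube_facet x t : 'I_m.+1 + 'I_n * bool := inr (t, Defs.coord x t == 1).

Lemma inside_clip x :
  inside clip_normal clip_offset goal_normal goal_offset x
  <-> (cube `&` polyhedron A r) x.
Proof.
rewrite /goal_normal /goal_offset; split=> [/insideP[H gx]|[Hc Hp]].
  split=> [t|i _].
    have := H (inr (t, false)); have := H (inr (t, true)).
    rewrite !affine_facet_cube /= subr_ge0 => h1 h0.
    by apply/andP.
  rewrite /halfspace /= -affine_row; have [->|im] := eqVneq i ord_max => //.
  by have := H (inl i); rewrite /= (negPf im).
apply/insideP; split=> [[i|[t hi]]|].
- rewrite /=; have [_|im] := eqVneq i ord_max.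
    rewrite /affine big1 ?add0r // => j _; by rewrite mxE mul0r.
  by rewrite affine_row; exact: (Hp i).
- rewrite affine_facet_cube /=; have := Hc t; move=> /andP[h0 h1].
  by case: hi => //; rewrite subr_ge0.
- by rewrite affine_row; exact: (Hp ord_max).
Qed.

Lemma activeE x : active clip_normal clip_offset x
  = ([set inl i | i in tight x] :|: [set cube_facet x t | t in bullets x])%SET.
Proof.
apply/setP => -[i|[t hi]]; rewrite !inE.
  rewrite (_ : _ \in [set cube_facet x t | t in bullets x]%SET = false) ?orbF; last first.
    by apply/imsetP => -[].
  rewrite mem_imset; last by move=> ? ? [].
  rewrite inE /=; have [_|im] := eqVneq i ord_max; last by rewrite affine_row.
  rewrite /affine big1 ?add0r ?oner_eq0 // => j _; by rewrite mxE mul0r.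
rewrite (_ : _ \in [set inl i | i in tight x]%SET = false) ?orFb; last first.
  by apply/imsetP => -[].
rewrite affine_facet_cube /=; apply/eqP/imsetP => [E|[t' t'b [-> ->]]].
  have xt : Defs.coord x t = hi%:R.
    rewrite /Defs.coord; case: hi E => [/eqP|->] //.
    by rewrite subr_eq0 => /eqP <-.
  exists t; first by rewrite !inE xt; case: (hi); rewrite eqxx ?orbT.
  by rewrite /cube_facet xt; case: (hi); rewrite ?eqxx // eq_sym oner_eq0.
move: t'b; rewrite !inE /Defs.coord => /orP[/eqP ->|/eqP ->].
  by rewrite eq_sym oner_eq0.
by rewrite eqxx subrr.
Qed.

Lemma cube_facet_inj x : injective (cube_facet x).
Proof. by move=> t t' []. Qed.

Lemma starsC x : stars x = (~: bullets x)%SET.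
Proof. by apply/setP => t; rewrite !inE negb_or. Qed.

Lemma card_active x :
  (#|active clip_normal clip_offset x| + #|stars x| = #|tight x| + n)%N.
Proof.
rewrite activeE cardsU (_ : _ :&: _ = finset.set0)%SET ?cards0 ?subn0; last first.
  by apply/setP => -[i|p]; rewrite !inE; apply/negP => /andP[/imsetP[] ? ? ? /imsetP[] ? ? ?].
rewrite card_imset; last by move=> ? ? [].
rewrite card_imset; last exact: cube_facet_inj.
by rewrite -addnA starsC cardsC card_ord.
Qed.

Lemma H_tight (I : {set 'I_m.+1}) x : ord_max \notin I -> cube x ->
  H_ A r I x <-> [/\ polyhedron A r x, 0 < Defs.g A r ord_max x & I \subset tight x].
Proof.
move=> Im xc; split=> [[[xI xP] xm]|[xP gx It]].
  have gx : 0 <= Defs.g A r ord_max x by exact: (xP ord_max).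
  split=> //; first by rewrite lt_neqAle gx andbT eq_sym; apply/eqP.
  apply/fintype.subsetP => i iI; rewrite inE; apply/andP; split.
    by apply: contraNneq Im => <-.
  by apply/eqP; exact: (xI i).
split; last by move=> /= gx0; rewrite gx0 ltxx in gx.
split=> // i /= /(fintype.subsetP It); rewrite inE => /andP[_ /eqP]; exact.
Qed.

Hypothesis condA : good_clipping_A A r.

(** Otherwise the point would lie in the interior of a face of the cube and on
    more of the hyperplanes than the dimension of that face; one more than the
    dimension of them already contradict condition (A). *)
Lemma card_active_le x :
  inside clip_normal clip_offset goal_normal goal_offset x ->
  0 < affine goal_normal goal_offset x ->
  (#|active clip_normal clip_offset x| <= n)%N.
Proof.
rewrite /goal_normal /goal_offset affine_row => /inside_clip[xc xP] gx.
have := card_active x; suff : (#|tight x| <= #|stars x|)%N by lia.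
rewrite leqNgt; apply/negP => lt.
have [I [cI It]] : exists I : {set 'I_m.+1}, #|I| = #|stars x|.+1 /\ I \subset tight x.
  have szle : (#|stars x|.+1 <= size (enum (tight x)))%N by rewrite -cardE.
  exists [set i in take #|stars x|.+1 (enum (tight x))]%SET; split.
    have -> : #|[set i in take #|stars x|.+1 (enum (tight x))]%SET|
        = size (take #|stars x|.+1 (enum (tight x))).
      by rewrite cardsE; apply/card_uniqP/take_uniq/enum_uniq.
    by rewrite size_takel.
  by apply/fintype.subsetP => i; rewrite inE => /mem_take; rewrite mem_enum.
have Im : ord_max \notin I.
  by apply/negP => /(fintype.subsetP It); rewrite inE eqxx.
have : (skeleton (#|I|%:Z - 1) `&` H_ A r I) x.
  split; first by split=> //; rewrite cI; lia.
  by apply/H_tight.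
by rewrite condA.
Qed.

(** The points of the double sum are the points with [n] tight constraints, and
    [I] is determined by the point: a hyperplane tight there but outside [I]
    would be an [n.+1]-st constraint. *)
Lemma skeleton_H_tight (I : {set 'I_m.+1}) x : ord_max \notin I ->
  (skeleton #|I|%:Z `&` H_ A r I) x <->
  [/\ inside clip_normal clip_offset goal_normal goal_offset x,
      0 < affine goal_normal goal_offset x,
      #|active clip_normal clip_offset x| = n & I = tight x].
Proof.
move=> Im; rewrite /goal_normal /goal_offset affine_row.
split=> [[[xc /eqP]]|[/inside_clip[xc xP] gx cx ->]].
  rewrite eqz_nat => /eqP sI /(H_tight Im xc)[xP gx It].
  have xin : inside clip_normal clip_offset goal_normal goal_offset x by apply/inside_clip.
  have := @card_active_le x xin; rewrite /goal_normal /goal_offset affine_row => /(_ gx) le.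
  have := card_active x; rewrite sI => ce.
  have le' := subset_leq_card It.
  split=> //; first by apply/eqP; rewrite eqn_leq le; move: ce le'; lia.
  by apply/eqP; rewrite eqEcard It -(leq_add2r n) -ce (addnC #|I|) leq_add2r.
have ce := card_active x; rewrite cx in ce.
split; first by split=> //; congr Posz; apply: (@addnI n); rewrite ce addnC.
apply/H_tight => //; by rewrite inE eqxx.
Qed.

End ClippedCube.

(** * Contributions of the vertices in terms of minors *)

(** The comparison of the two forms of a contribution, where [G] is the value of
    the objective, [D] the minor on [I], [k] and [l] the numbers of half-spaces
    and of cube facets at the vertex, [z] the number of zero coordinates, and
    [PW] and [PR] the products of the weights of the half-spaces and of the
    residuals of the cube facets. *)
Lemma sign_bookkeeping (R : realType) (G D PW PR : R) (k l z e : nat) :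
  D != 0 ->
  divpow (k + l) G / (`|D| * ((-1) ^+ (k + z) * PW * PR))
  = (-1) ^+ (z + e + (k + l) * k) * (G * D) ^+ (k + l)
    / ((k + l)`!%:R * `|D| * ((-1) ^+ e * PW * D ^+ k)
       * ((-1) ^+ (k * l) * PR * D ^+ l)).
Proof.
move=> D0; have nD0 : `|D| != 0 by rewrite normr_eq0.
have sI h : ((-1) ^+ h)^-1 = (-1) ^+ h :> R.
  by rewrite -signr_odd; case: odd; rewrite ?expr0 ?expr1 ?invr1 ?invrN1.
have -> : (-1) ^+ (z + e + (k + l) * k)
    = ((-1) ^+ (k + z))^-1 * (-1) ^+ e * (-1) ^+ (k * l) :> R.
  rewrite sI -!exprD -signr_odd -[RHS]signr_odd !oddD !oddM !oddD; congr (_ ^+ nat_of_bool _).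
  by case: (odd k); case: (odd l); case: (odd z); case: (odd e).
rewrite /divpow exprMn (exprD D).
have s0 h : (-1) ^+ h != 0 :> R by rewrite signr_eq0.
have f0 : (k + l)`!%:R != 0 :> R by rewrite pnatr_eq0 -lt0n fact_gt0.
have [->|PW0] := eqVneq PW 0; first by rewrite !(mulr0, mul0r, invr0).
have [->|PR0] := eqVneq PR 0; first by rewrite !(mulr0, mul0r, invr0).
have := s0 (k + z)%N; have := s0 e; have := s0 (k * l)%N; have := f0.
have := expf_neq0 k D0; have := expf_neq0 l D0; move: nD0.
move: `|D| (D ^+ k) (D ^+ l) ((-1) ^+ (k + z)) ((-1) ^+ e) ((-1) ^+ (k * l))
  ((k + l)`!%:R) (G ^+ (k + l)) => aD Dk Dl s1 s2 s3 nf X h1 h2 h3 h4 h5 h6 h7.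
by field; rewrite h1 h2 h3 h4 h5 h6 h7 PW0 PR0.
Qed.

Section VertexTerm.
Context {R : realType} {n m : nat} (A : 'M[R]_(n, m.+1)) (r : 'I_m.+1 -> R).
Implicit Types (x v : euclid R n) (i : 'I_m.+1) (t : 'I_n).
Local Notation cn := (clip_normal A).
Local Notation co := (clip_offset r).

Lemma big_active (S : Type) (idx : S) (op : Monoid.com_law idx) x
    (F : 'I_m.+1 + 'I_n * bool -> S) :
  \big[op/idx]_(tau in active cn co x) F tau
  = op (\big[op/idx]_(i in tight A r x) F (inl i))
       (\big[op/idx]_(t in bullets x) F (cube_facet x t)).
Proof.
rewrite activeE; set X := [set inl i | i in _]%SET; set Y := [set cube_facet x t | t in _]%SET.
rewrite (eq_bigl [in [predU X & Y]]) => [|tau]; last by rewrite !inE.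
rewrite bigU /=; last first.
  rewrite disjoint_subset; apply/fintype.subsetP => _ /imsetP[i _ ->].
  by rewrite !inE; apply/imsetP => -[].
congr (op _ _); rewrite big_imset //=; last by move=> ? ? _ _; exact: cube_facet_inj.
by move=> ? ? _ _ [].
Qed.

Lemma enum_setD1 (S : {set 'I_m.+1}) i : enum (S :\ i)%SET = rem i (enum S).
Proof.
rewrite rem_filter ?enum_uniq // /enum_mem -filter_predI; apply: eq_filter => l.
by rewrite !inE.
Qed.

Context (condA : good_clipping_A A r) (condB : good_clipping_B A r).
Context (f : {ffun 'I_n -> 'I_m.+1 + 'I_n * bool}).
Let go : 'rV[R]_n := \row_j A j ord_max.
Hypothesis fcut : cuts_vertex cn co go (r ord_max) f.
Let v := vertex cn co f.
Let I := tight A r v.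

Let fU : normals cn f \in unitmx. Proof. by case/and3P: fcut. Qed.
Let vin : inside cn co go (r ord_max) v. Proof. by case/and3P: fcut. Qed.
Let gv : 0 < affine go (r ord_max) v. Proof. by case/and3P: fcut. Qed.

Let act_f : active cn co v = [set f p | p in 'I_n]%SET.
Proof. by apply: active_codom => //; exact: card_active_le. Qed.

Let finj : injective f. Proof. exact: normals_inj fU. Qed.

Let card_act : #|active cn co v| = n.
Proof. by rewrite act_f card_imset // card_ord. Qed.

Let maxI : ord_max \notin I. Proof. by rewrite inE eqxx. Qed.

Let v_skel : (skeleton #|I|%:Z `&` H_ A r I) v.
Proof. by apply/skeleton_H_tight. Qed.

Let card_stars : #|stars v| = #|I|.
Proof. by case: v_skel => [[_ /eqP]]; rewrite eqz_nat => /eqP. Qed.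

(** The weights indexed by the constraints themselves, which makes them
    independent of the order in which [f] lists these. *)
Definition weight_of tau : R := \sum_(p | f p == tau) weights cn go f 0 p.

Lemma weight_of_f p : weight_of (f p) = weights cn go f 0 p.
Proof. by rewrite /weight_of (big_pred1 p) // => q; rewrite (inj_eq finj). Qed.

(** Read in the coordinates that are neither [0] nor [1], the decomposition of
    the objective is a linear system for the weights of the half-spaces; in each
    other coordinate it gives the weight of one cube facet as a residual. *)
Lemma goal_decomposition j : A j ord_max
  = \sum_(i in I) weight_of (inl i) * A j i
    + (if j \in bullets v then (-1) ^+ (Defs.coord v j == 1) * weight_of (cube_facet v j)
       else 0).
Proof.
have /rowP/(_ j) := weights_sum go fU; rewrite [RHS]mxE => <-; rewrite summxE.
rewrite (eq_bigr (fun p => weight_of (f p) * cn (f p) 0 j)); last first.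
  by move=> p _; rewrite mxE weight_of_f.
rewrite -(big_imset (fun tau => weight_of tau * cn tau 0 j)) /=; last first.
  by move=> ? ? _ _; exact: finj.
rewrite -act_f big_active; congr (_ + _).
  apply: eq_bigr => i; rewrite inE => /andP[im _].
  by rewrite /= (negPf im) mxE.
under eq_bigr do rewrite /= !mxE eqxx /=.
case: ifP => jb.
  rewrite (bigD1 j) //= big1 => [|t /andP[_ tj]].
    by rewrite eqxx mulr1 addr0 mulrC.
  by rewrite (eq_sym j) (negPf tj) !mulr0.
rewrite big1 // => t tb; rewrite (_ : (j == t) = false) ?mulr0 //.
by apply: contraFF jb => /eqP ->.
Qed.

Let colE j : j \in enum (stars v) ->
  A j ord_max = \sum_(i <- enum I) weight_of (inl i) * A j i.
Proof.
rewrite mem_enum starsC inE => jb; rewrite [LHS]goal_decomposition (negPf jb) addr0.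
by rewrite big_enum.
Qed.

Let residE t : t \in bullets v ->
  A t ord_max - \sum_(i <- enum I) weight_of (inl i) * A t i
  = (-1) ^+ (Defs.coord v t == 1) * weight_of (cube_facet v t).
Proof. by move=> tb; rewrite [A t ord_max]goal_decomposition tb big_enum /= addrC addKr. Qed.

Let size_enum : size (enum (stars v)) = size (enum I).
Proof. by rewrite -!cardE. Qed.

(** A vanishing weight is a linear relation among the columns of one of the
    minors of condition (B). *)
Lemma weights_neq0 p : weights cn go f 0 p != 0.
Proof.
rewrite -weight_of_f; have := condB maxI v_skel.
rewrite mulf_eq0 negb_or => /andP[/prodf_neq0 bI /prodf_neq0 bB].
(* The decomposition of the objective as a relation among columns of [A]. *)
pose W i := if i == ord_max then -1 else weight_of (inl i).
have sumW (S : {set 'I_m.+1}) j : ord_max \notin S -> 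
    \sum_(i <- enum (ord_max |: S)%SET) W i * A j i
    = - A j ord_max + \sum_(i in S) weight_of (inl i) * A j i.
  move=> mS; rewrite big_enum /= big_setU1 //= /W eqxx mulN1r; congr (_ + _).
  by apply: eq_bigr => i iS; case: eqP => // iE; rewrite -iE iS in mS.
have maxW (S : {set 'I_m.+1}) : has (fun i => W i != 0) (enum (ord_max |: S)%SET).
  apply/hasP; exists ord_max; first by rewrite mem_enum !inE eqxx.
  by rewrite /W eqxx oppr_eq0 oner_eq0.
have : f p \in active cn co v by rewrite act_f imset_f.
rewrite activeE inE => /orP[/imsetP[i iI ->]|/imsetP[t tb ->]].
  apply/negP => /eqP w0; have /negP := bI i iI; apply; apply/eqP.
  have mIi : ord_max \notin (I :\ i)%SET by rewrite in_setD1 negb_and maxI orbT.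
  apply: (@minor_dependent _ _ _ _ _ _ W) => //.
  - by rewrite -!cardE cardsU1 mIi card_stars (cardsD1 i I) iI.
  - exact: enum_uniq.
  - move=> j js; rewrite sumW // (colE js) big_enum /= [X in - X](bigD1 i) //= w0 mul0r add0r.
    apply/eqP; rewrite addrC subr_eq0; apply/eqP/eq_bigl => l.
    by rewrite !inE andbC.
apply/negP => /eqP w0; have /negP := bB t tb; apply; apply/eqP.
have tS : t \notin stars v by rewrite starsC inE tb.
apply: (@minor_dependent _ _ _ _ _ _ W) => //.
- by rewrite -!cardE !cardsU1 tS maxI card_stars.
- exact: enum_uniq.
- move=> j; rewrite mem_enum sumW // !inE => /orP[/eqP ->|js].
    have := residE tb; rewrite w0 mulr0 => /eqP; rewrite subr_eq0 => /eqP ->.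
    by rewrite big_enum addNr.
  have := @colE j; rewrite mem_enum inE => /(_ js) ->.
  by rewrite big_enum addNr.
Qed.

(** The facets of the cube have unit normals, so up to sign only the rows of the
    half-spaces in the non-integral coordinates remain. *)
Lemma norm_det_normals (n_gt0 : (0 < n)%N) :
  `|\det (normals cn f)| = `|minor A (enum (stars v)) (enum I)|.
Proof.
(* An ordering of the tight constraints that puts the facet of each coordinate
   equal to [0] or [1] in the row of that coordinate. *)
pose f0 : {ffun 'I_n -> 'I_m.+1 + 'I_n * bool} := [ffun j =>
  if j \in stars v then inl (nth ord_max (enum I) (index j (enum (stars v))))
  else cube_facet v j].
have ltS j : j \in stars v -> (index j (enum (stars v)) < size (enum I))%N.
  by move=> js; rewrite -size_enum index_mem mem_enum.
have f0inj : injective f0.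
  move=> j j'; rewrite !ffunE; case: ifP => js; case: ifP => js' //.
    case=> /eqP; rewrite nth_uniq ?enum_uniq ?ltS // => /eqP E.
    by rewrite -[j](nth_index j (s := enum (stars v))) ?mem_enum // E nth_index ?mem_enum.
  exact: cube_facet_inj.
have f0act p : exists q, f0 p = f q.
  suff : f0 p \in active cn co v by rewrite act_f => /imsetP[q _ ->]; exists q.
  rewrite activeE inE ffunE; apply/orP; case: ifP => ps; [left|right].
    by apply/imset_f; rewrite -mem_enum mem_nth // ltS.
  apply/imset_f; apply: contraFT ps; by rewrite starsC finset.in_setC.
have [s f0E] := injective_same_image f0inj f0act.
have -> : `|\det (normals cn f)| = `|\det (normals cn f0)|.
  rewrite (_ : normals cn f0 = row_perm s (normals cn f)); last first.
    by apply/matrixP => p q; rewrite !mxE f0E ffunE.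
  by rewrite row_permE det_mulmx det_perm normrM normrX normrN1 expr1n mul1r.
rewrite (@norm_det_unit_rows _ _ _ (stars v) (fun j => (-1) ^+ (Defs.coord v j == 1))).
- have szS : size (enum (stars v)) = #|stars v| by rewrite cardE.
  have szI : size (enum I) = #|stars v| by rewrite card_stars cardE.
  rewrite (minor_nth A (Ordinal n_gt0) ord_max szS szI).
  rewrite -det_tr; congr (`|\det _|); apply/matrixP => p q; rewrite !mxE.
  rewrite ffunE enum_valP /= ifN; last first.
    apply: contraNneq maxI => <-; rewrite -mem_enum mem_nth // ltS //; exact: enum_valP.
  rewrite mxE (enum_val_nth (Ordinal n_gt0)) [X in index X _](enum_val_nth (Ordinal n_gt0)).
  by rewrite index_uniq ?enum_uniq // -cardE.
- by move=> j; rewrite normrX normrN1 expr1n.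
- by move=> j k js; rewrite mxE ffunE (negPf js) /= !mxE eqxx /= (eq_sym k).
Qed.

Let D : R := minor A (enum (stars v)) (enum I).

(** The normal of [x_t >= 0] is the coordinate vector and that of [1 - x_t >= 0]
    its opposite, so negating the weight gives back the residual with a sign
    exactly for the coordinates equal to [0]. *)
Lemma prod_neg_weights : \prod_p - weights cn go f 0 p
  = (-1) ^+ (#|I| + #|zeros v|) * \prod_(i in I) weight_of (inl i)
    * \prod_(t in bullets v)
        (A t ord_max - \sum_(i <- enum I) weight_of (inl i) * A t i).
Proof.
transitivity (\prod_(tau in active cn co v) - weight_of tau).
  rewrite act_f big_imset /=; last by move=> ? ? _ _; exact: finj.
  by apply: eq_bigr => p _; rewrite weight_of_f.
rewrite big_active /= prodrN exprD -!mulrA; congr (_ * _); rewrite [RHS]mulrCA; congr (_ * _).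
have -> : (-1) ^+ #|zeros v| = \prod_(t in bullets v) (-1) ^+ (t \in zeros v) :> R.
  rewrite prodrXr; congr (_ ^+ _); rewrite -sum1_card big_mkcond [RHS]big_mkcond /=.
  by apply: eq_bigr => t _; rewrite finset.in_setU; case: (t \in zeros v) => //=; case: ifP.
rewrite -big_split; apply: eq_bigr => t tb /=; rewrite residE // mulrA -signr_addb.
rewrite [_ (+) _](_ : _ = true) ?expr1 ?mulN1r // inE.
move: tb; rewrite !inE => /orP[/eqP ->|/eqP ->]; first by rewrite eqxx eq_sym oner_eq0.
by rewrite eqxx oner_eq0.
Qed.

(** Each factor is Cramer's rule with the replaced column moved last; the moves
    of all the columns add up to a reversal of [I]. *)
Lemma prod_minor_replace :
  \prod_(t in I) minor A (enum (stars v)) (enum (I :\ t)%SET ++ [:: ord_max])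
  = (-1) ^+ (#|I| * (#|I| - 1) %/ 2)
    * \prod_(i in I) weight_of (inl i) * D ^+ #|I|.
Proof.
transitivity (\prod_(t in I)
    ((-1) ^+ (index t (enum I) + #|I|.-1) * weight_of (inl t) * D)).
  apply: eq_bigr => t tI; rewrite cats1 enum_setD1.
  rewrite (minor_replace size_enum (enum_uniq I) _ colE) ?mem_enum //.
  by rewrite -cardE.
rewrite !big_split /= prodr_const; congr (_ * _ * _).
rewrite prodrXr big_split /= sum_nat_const.
have -> : (\sum_(t in I) index t (enum I) = 'C(#|I|, 2))%N.
  rewrite -big_enum /= (big_nth ord_max) -cardE -bin2_sum.
  by apply: eq_big_nat => q /andP[_ qI]; rewrite index_uniq ?enum_uniq // -cardE.
rewrite bin2 divn2 subn1 exprD [X in _ * X](_ : _ = 1) ?mulr1 //.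
by rewrite -signr_odd oddM; case: #|I| => //= k; rewrite andNb.
Qed.

Lemma prod_minor_border :
  \prod_(t in bullets v) minor A (enum (stars v) ++ [:: t]) (ord_max :: enum I)
  = (-1) ^+ (#|I| * #|bullets v|)
    * \prod_(t in bullets v)
        (A t ord_max - \sum_(i <- enum I) weight_of (inl i) * A t i)
    * D ^+ #|bullets v|.
Proof.
rewrite exprM -2![_ ^+ #|bullets v|]prodr_const -!big_split /=; apply: eq_bigr => t tb.
by rewrite cats1 (minor_border _ size_enum colE) -cardE card_stars.
Qed.

Lemma vertex_volume_term (n_gt0 : (0 < n)%N) :
  vertex_volume cn co go (r ord_max) 0 f = vertex_term A r I v.
Proof.
rewrite /vertex_volume fcut addn0.
rewrite norm_det_normals // prod_neg_weights /vertex_term.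
rewrite prod_minor_replace prod_minor_border -/D affine_row.
have D0 : D != 0.
  by rewrite -normr_eq0 /D -norm_det_normals // normr_eq0 -unitfE -unitmxE.
have nE : (n = #|I| + #|bullets v|)%N.
  by rewrite -card_stars starsC addnC cardsC card_ord.
set G := Defs.g _ _ _ _; set PW := \prod_(i in I) _; set PR := \prod_(t in bullets v) _.
set z := #|zeros v|; set k := #|I| in nE *; set l := #|bullets v| in nE *.
set C2 := (k * (k - 1) %/ 2)%N.
rewrite [in LHS]nE [in X in _ = X]nE.
exact: sign_bookkeeping.
Qed.

End VertexTerm.

Theorem theorem4p9 (R : realType) (n m : nat) (A : 'M[R]_(n, m.+1))
    (r : 'I_m.+1 -> R)
    (n_ge1 : (1 <= n)%N)
    (g_nonconstant : forall i, nonconstant (g A r i))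
    (condA : good_clipping_A A r)
    (condB : good_clipping_B A r) :
  lebesgue_point n (cube `&` polyhedron A r)
  = (\sum_(I : {set 'I_m.+1} | ord_max \notin I)
       \sum_(v \in skeleton #|I|%:Z `&` H_ A r I) vertex_term A r I v)%:E.
Proof.
pose c := clip_normal A; pose d : 'I_m.+1 + 'I_n * bool -> R := clip_offset r.
pose a : 'rV[R]_n := \row_j A j ord_max; pose b := r ord_max.
have PE : cube `&` polyhedron A r = [set x | inside c d a b x].
  by apply/seteqP; split=> x /inside_clip.
have bnd x : inside c d a b x -> forall j, `|tnth x j| <= 1.
  move=> /inside_clip[xc _] j; have /andP[x0 x1] := xc j.
  by rewrite ger0_norm.
have a0 : a != 0.
  have [x [y xy]] := g_nonconstant ord_max; apply/negP => /eqP a0; apply: xy.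
  by rewrite -!affine_row -/a a0 /affine !big1 // => j _; rewrite mxE mul0r.
have card x : inside c d a b x -> 0 < affine a b x -> (#|active c d x| <= n)%N.
  exact: card_active_le.
have volE := @integral_polyhedron R _ n c d a b 1 0.
have -> : lebesgue_point n (cube `&` polyhedron A r)
    = (\int[lebesgue_point n]_(x in [set x | inside c d a b x])
         (divpow 0 (affine a b x))%:E)%E.
  rewrite PE (eq_integral (fun=> 1%:E)) => [|x _]; last by rewrite /divpow expr0 fact0 divr1.
  by rewrite integral_cst ?mul1e //; exact: measurable_inside.
rewrite volE ?a0 //; first last.
- by move=> f fU fP fg p; apply: (weights_neq0 condA condB); rewrite /cuts_vertex fU fP.
- by move=> x xP gx lam lamx lam0; exact: active_independent bnd card xP gx lamx lam0.
congr (_%:E).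
rewrite (sum_vertex_volume (F := fun v => vertex_term A r (tight A r v) v) card); last first.
  by move=> f fc; rewrite vertex_volume_term.
rewrite mulrAC divff ?mul1r; last by rewrite pnatr_eq0 -lt0n fact_gt0.
(* The inner sum of the statement ranges over the vertices at which exactly the
   half-spaces in [I] are tight. *)
have fiberE (I : {set 'I_m.+1}) : ord_max \notin I ->
    skeleton #|I|%:Z `&` H_ A r I
    = [set` [seq v <- vertices c d a b | tight A r v == I]].
  move=> Im; apply/seteqP; split=> v /=.
    move=> /(skeleton_H_tight condA _ Im)[vP gv cv ->].
    rewrite mem_filter eqxx /=; apply/mem_vertices.
    have [v' [v'P gv' vv' span]] := exists_vertex bnd vP gv.
    have actE : active c d v = active c d v'.
      by apply/eqP; rewrite eqEcard vv' cv card.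
    have [f fv fU] := spanning_basis span.
    have vE : vertex c d f = v.
      apply: vertex_unique => // p; have := fv p.
      by rewrite -actE inE => /eqP.
    by exists f => //; rewrite /cuts_vertex vE fU vP gv.
  rewrite mem_filter => /andP[/eqP <- /mem_vertices[f /and3P[fU fP fg] ->]].
  apply/skeleton_H_tight => //; first by rewrite inE eqxx.
  split=> //; rewrite (active_codom fU erefl) ?card_imset ?card_ord //.
    exact: normals_inj fU.
  exact: card.
rewrite (eq_bigr (fun I => \sum_(v <- vertices c d a b | tight A r v == I)
    vertex_term A r I v)); last first.
  move=> I Im; rewrite fiberE // -fsbig_seq; last by apply: filter_uniq; exact: undup_uniq.
  by rewrite big_filter.
rewrite (exchange_big_dep predT) //=; apply: eq_bigr => v _.
rewrite (big_pred1 (tight A r v)) // => I /=.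
have [->|_] := eqVneq I (tight A r v); last by rewrite andbF.
by rewrite andbT inE eqxx.
Qed.
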